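(* Let $f=h+\overline{g}$ be a sense-preserving harmonic mapping in $\mathbb{D}$, and suppose $\|P_f\|\leq M$. Put $t=2\tanh^{-1}\left(\frac{1}{8(M+1)}\right)$. Then $f$ is univalent in the hyperbolic disk $D_h(z,t)$ for each $z\in\mathbb{D}$. Consequently, $f$ is uniformly locally univalent in $\mathbb{D}$ and its uniformly hyperbolic radius $\rho(f)$ is no less than $t$.
   Context: $\mathbb{D}=\{z\in\mathbb{C}:|z|<1\}$. A harmonic mapping in $\mathbb{D}$ is written $f=h+\overline{g}$ with $h,g$ analytic in $\mathbb{D}$, $g(0)=0$; it is sense-preserving if $|h'|^2-|g'|^2>0$ in $\mathbb{D}$. Its pre-Schwarzian derivative and norm are $$P_f=\frac{h''\overline{h'}-g''\overline{g'}}{|h'|^2-|g'|^2},\qquad \|P_f\|=\sup_{z\in\mathbb{D}}(1-|z|^2)|P_f(z)|.$$ Hyperbolic distance: $d_h(z,a)=2\tanh^{-1}\left|\frac{z-a}{1-\overline{a}z}\right|$ for $z,a\in\mathbb{D}$; hyperbolic disk $D_h(a,\rho)=\{z\in\mathbb{D}:d_h(z,a)<\rho\}$. The uniformly hyperbolic radius of $f$ is $$\rho(f)=\inf_{z\in\mathbb{D}}\Big\{\sup_{\rho_z>0}\{\rho_z: f\text{ is univalent in }D_h(z,\rho_z)\}\Big\},$$ and $f$ is uniformly locally univalent (ULU) in $\mathbb{D}$ if $\rho(f)>0$. *)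

(* Defs.v *)
From Stdlib Require Import Reals.
From Coquelicot Require Import Coquelicot.
Open Scope R_scope.

Definition unit_disk (z : C) : Prop := Cmod z < 1.

(* With scalars in [C_AbsRing] this is complex differentiability; under it the
   total operator [C_derive] used below is the complex derivative. *)
Definition analytic_in_disk (h : C -> C) : Prop :=
  forall z : C, unit_disk z -> @ex_derive C_AbsRing C_NormedModule h z.

(* [f] is a harmonic mapping of the disk with canonical decomposition
   [h + conj g]; the values of [f], [h], [g] off the disk are irrelevant. *)
Definition harmonic_mapping (f h g : C -> C) : Prop :=
  analytic_in_disk h /\ analytic_in_disk g /\ g (RtoC 0) = RtoC 0 /\
  (forall z : C, unit_disk z -> f z = (h z + Cconj (g z))%C).

Definition jacobian (h g : C -> C) (z : C) : R :=
  Cmod (C_derive h z) ^ 2 - Cmod (C_derive g z) ^ 2.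

Definition sense_preserving (h g : C -> C) : Prop :=
  forall z : C, unit_disk z -> jacobian h g z > 0.

Definition pre_schwarzian (h g : C -> C) (z : C) : C :=
  ((C_derive (C_derive h) z * Cconj (C_derive h z)
    - C_derive (C_derive g) z * Cconj (C_derive g z))
   / RtoC (jacobian h g z))%C.

Definition pre_schwarzian_norm (h g : C -> C) : Rbar :=
  Lub_Rbar (fun x : R => exists z : C,
    unit_disk z /\ x = (1 - Cmod z ^ 2) * Cmod (pre_schwarzian h g z)).

(* Inverse hyperbolic tangent, for -1 < x < 1. *)
Definition artanh (x : R) : R := ln ((1 + x) / (1 - x)) / 2.

Definition hyp_dist (z a : C) : R :=
  2 * artanh (Cmod ((z - a) / (RtoC 1 - Cconj a * z))%C).

Definition hyp_disk (a : C) (r : R) (z : C) : Prop :=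
  unit_disk z /\ hyp_dist z a < r.

Definition univalent_in (f : C -> C) (D : C -> Prop) : Prop :=
  forall z w : C, D z -> D w -> f z = f w -> z = w.

(* Both the suprema and the infimum are taken in the extended reals: the
   supremum at [z] is infinite when [f] is univalent in the whole disk. *)
Definition hyp_radius_at (f : C -> C) (z : C) : Rbar :=
  Lub_Rbar (fun r : R => 0 < r /\ univalent_in f (hyp_disk z r)).

Definition hyp_radius (f : C -> C) : Rbar :=
  Rbar_glb (fun x : Rbar => exists z : C, unit_disk z /\ x = hyp_radius_at f z).

Definition uniformly_locally_univalent (f : C -> C) : Prop :=
  Rbar_lt (Finite 0) (hyp_radius f).

(* Main.v *)
Require Import Defs.
From Stdlib Require Import Reals Lra Psatz.
From Coquelicot Require Import Coquelicot.
Open Scope R_scope.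

(** If [f = h + Cconj g] takes the same value at two points, then [h] and [g]
    have increments of equal modulus there, so [h + e * g] takes the same value
    at both points for some unimodular [e]. It is therefore enough to show that
    all these analytic functions are univalent
    ([univalent_of_analytic_shears]).

    Put [phi = h + e * g] and [omega = g' / h'], so that [|omega| < 1]. A
    computation gives
    [|phi'' / phi' - P_f| = |omega'| / (1 - |omega|^2)], and by a Schwarz-Pick
    estimate the right-hand side is at most [2 / (1 - |z|^2)]
    ([weak_schwarz_pick]); hence
    [|phi'' / phi'| <= (M + 2) / (1 - |z|^2)] ([analytic_shear_bound]). The
    hyperbolic disk around [a] lies in a Euclidean ball of radius
    [d = (1 - |a|^2) / (7 * (M + 1))] ([hyp_disk_in_ball]), on which this bound
    makes [|phi'' / phi'| * d <= 1 / 2]. By Gronwall's inequality [phi'] then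
    keeps a positive real part relative to [phi' a]
    ([slow_path_half_plane]), and since a ball is convex, [phi] is univalent
    there ([univalent_ball]).

    The functions [h] and [g] are only assumed to have a complex derivative at
    each point, so the existence of [h''] and [g''] and the Schwarz-Pick
    estimate rest on the Cauchy integral formula under that hypothesis. It is
    proved by Goursat's bisection ([additive_rectangle_function_zero]), applied
    to [f w / (w - z) dw] in coordinates that contract a circle onto the point
    [z] inside it ([cauchy_formula]). Differentiating the kernel shows that
    derivatives are again differentiable ([holo_C_derive]). Comparing the first
    Fourier coefficients of [p] and [Cconj p] on circles gives Caratheodory's
    inequality [|p' 0| <= 2 * Re (p 0)] for [Re p >= 0] ([caratheodory]), from
    which the Schwarz-Pick estimate follows. *)

(** * Moduli of complex numbers *)

Lemma C_ext (x y : C) : Re x = Re y -> Im x = Im y -> x = y.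
Proof. destruct x, y; unfold Re, Im; simpl; intros; subst; reflexivity. Qed.

Lemma Cmod_sub_sym (x y : C) : Cmod (x - y)%C = Cmod (y - x)%C.
Proof. rewrite <- Cmod_opp. f_equal; ring. Qed.

Lemma Cmod_sub_triangle (x y : C) : Cmod (x - y)%C <= Cmod x + Cmod y.
Proof. unfold Cminus; rewrite <- (Cmod_opp y). apply Cmod_triangle. Qed.

Lemma Cmod_ge_sub (x y : C) : Cmod x - Cmod y <= Cmod (x - y)%C.
Proof.
  pose proof (Cmod_triangle (x - y)%C y) as H.
  replace (x - y + y)%C with x in H by ring. lra.
Qed.

Lemma im_le_Cmod (c : C) : Rabs (Im c) <= Cmod c.
Proof.
  eapply Rle_trans; [|apply (Rmax_Cmod c)]. apply Rmax_r.
Qed.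

Lemma Cmod_le_ReIm (c : C) : Cmod c <= Rabs (Re c) + Rabs (Im c).
Proof.
  destruct c as [x y]; unfold Re, Im; simpl.
  replace (x, y) with (RtoC x + RtoC y * Ci)%C
    by (apply C_ext; unfold Re, Im; simpl; ring).
  eapply Rle_trans; [apply Cmod_triangle|].
  rewrite Cmod_mult, Cmod_Ci, !Cmod_R; lra.
Qed.

(** * Complex derivatives *)

Definition ccont (f : C -> C) (z : C) : Prop :=
  forall eps, 0 < eps -> exists delta, 0 < delta /\
    forall w, Cmod (w - z)%C < delta -> Cmod (f w - f z)%C < eps.

Definition cdiff (f : C -> C) (z l : C) : Prop :=
  forall eps, 0 < eps -> exists delta, 0 < delta /\
    forall w, Cmod (w - z)%C < delta ->
      Cmod (f w - f z - (w - z) * l)%C <= eps * Cmod (w - z)%C.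

Lemma cdiff_of_is_derive (f : C -> C) (z l : C) :
  @is_derive C_AbsRing C_NormedModule f z l -> cdiff f z l.
Proof.
  intros [_ H] eps He.
  destruct (H z (fun P HP => HP) (mkposreal eps He)) as [d Hd].
  exists (d). split; [apply cond_pos|].
  intros w Hw.
  specialize (Hd w). simpl in Hd.
  exact (Hd Hw).
Qed.

Lemma is_derive_of_cdiff (f : C -> C) (z l : C) :
  cdiff f z l -> @is_derive C_AbsRing C_NormedModule f z l.
Proof.
  intros H. split.
  - apply is_linear_scal_l.
  - intros x Hx eps.
    assert (Hxz : z = x).
    { apply (@is_filter_lim_locally_unique C_AbsRing (AbsRing_NormedModule C_AbsRing)). exact Hx. }
    subst x.
    destruct (H eps (cond_pos eps)) as [d [Hd1 Hd2]].
    exists (mkposreal d Hd1). intros y Hy.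
    apply (Hd2 y). exact Hy.
Qed.

Lemma ccont_const (c z : C) : ccont (fun _ => c) z.
Proof.
  intros eps He. exists 1; split; [lra|]. intros w _.
  replace (c - c)%C with (RtoC 0) by ring. rewrite Cmod_0; lra.
Qed.

Lemma ccont_id (z : C) : ccont (fun w => w) z.
Proof. intros eps He. exists eps; split; auto. Qed.

Lemma ccont_plus (f g : C -> C) (z : C) :
  ccont f z -> ccont g z -> ccont (fun w => f w + g w)%C z.
Proof.
  intros Hf Hg eps He.
  destruct (Hf (eps / 2)) as [d1 [Hd1 H1]]; [lra|].
  destruct (Hg (eps / 2)) as [d2 [Hd2 H2]]; [lra|].
  exists (Rmin d1 d2); split; [apply Rmin_pos; auto|].
  intros w Hw.
  pose proof (Rmin_l d1 d2); pose proof (Rmin_r d1 d2).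
  replace (f w + g w - (f z + g z))%C with ((f w - f z) + (g w - g z))%C by ring.
  pose proof (Cmod_triangle (f w - f z)%C (g w - g z)%C).
  specialize (H1 w ltac:(lra)); specialize (H2 w ltac:(lra)). lra.
Qed.

Lemma ccont_mult (f g : C -> C) (z : C) :
  ccont f z -> ccont g z -> ccont (fun w => f w * g w)%C z.
Proof.
  intros Hf Hg eps He.
  pose proof (Cmod_ge_0 (f z)) as Pf; pose proof (Cmod_ge_0 (g z)) as Pg.
  set (K := Cmod (f z) + Cmod (g z) + 1).
  assert (HK : 0 < K) by (unfold K; lra).
  set (e := Rmin 1 (eps / (2 * K))).
  assert (He' : 0 < e) by (apply Rmin_pos; [lra|apply Rdiv_lt_0_compat; lra]).
  destruct (Hf e He') as [d1 [Hd1 H1]].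
  destruct (Hg e He') as [d2 [Hd2 H2]].
  exists (Rmin d1 d2); split; [apply Rmin_pos; auto|].
  intros w Hw.
  pose proof (Rmin_l d1 d2); pose proof (Rmin_r d1 d2).
  specialize (H1 w ltac:(lra)); specialize (H2 w ltac:(lra)).
  replace (f w * g w - f z * g z)%C
    with ((f w - f z) * (g w - g z) + (f z * (g w - g z) + (f w - f z) * g z))%C
    by ring.
  assert (e <= 1) by apply Rmin_l.
  assert (HeK : e * K <= eps / 2).
  { replace (eps / 2) with (eps / (2 * K) * K) by (field; lra).
    apply Rmult_le_compat_r; [lra|apply Rmin_r]. }
  eapply Rle_lt_trans; [apply Cmod_triangle|].
  eapply Rle_lt_trans; [apply Rplus_le_compat_l, Cmod_triangle|].
  rewrite !Cmod_mult.
  pose proof (Cmod_ge_0 (f w - f z)%C); pose proof (Cmod_ge_0 (g w - g z)%C).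
  assert (Cmod (f w - f z)%C * Cmod (g w - g z)%C <= e * 1)
    by (apply Rmult_le_compat; lra).
  assert (Cmod (f z) * Cmod (g w - g z)%C <= Cmod (f z) * e)
    by (apply Rmult_le_compat_l; lra).
  assert (Cmod (f w - f z)%C * Cmod (g z) <= e * Cmod (g z))
    by (apply Rmult_le_compat_r; lra).
  unfold K in HeK. nra.
Qed.

Lemma ccont_comp (f g : C -> C) (z : C) :
  ccont f z -> ccont g (f z) -> ccont (fun w => g (f w)) z.
Proof.
  intros Hf Hg eps He.
  destruct (Hg eps He) as [d [Hd H]].
  destruct (Hf d Hd) as [d' [Hd' H']].
  exists d'; split; auto.
Qed.

(** Caratheodory's form of differentiability, in which the product and chain
    rules become continuity of products and compositions. *)
Lemma cdiff_slope (f : C -> C) (z l : C) :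
  cdiff f z l <->
  exists q, (forall w, f w = f z + (w - z) * q w)%C /\ q z = l /\ ccont q z.
Proof.
  split.
  - intros H.
    exists (fun w => if Ceq_dec w z then l
                     else ((f w - f z) / (w - z))%C).
    split; [|split].
    + intros w. destruct (Ceq_dec w z) as [->|N].
      * ring.
      * field. intro E. apply N. replace w with ((w - z) + z)%C by ring.
        rewrite E; ring.
    + destruct (Ceq_dec z z); congruence.
    + intros eps He.
      destruct (H (eps / 2)) as [d [Hd H1]]; [lra|].
      exists d; split; auto. intros w Hw.
      destruct (Ceq_dec z z) as [_|N]; [|congruence].
      destruct (Ceq_dec w z) as [->|N].
      * replace (l - l)%C with (RtoC 0) by ring. rewrite Cmod_0; lra.
      * assert (N' : (w - z)%C <> 0).
        { intro E. apply N. replace w with ((w - z) + z)%C by ring.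
          rewrite E; ring. }
        assert (P : 0 < Cmod (w - z)%C) by (apply Cmod_gt_0; auto).
        replace ((f w - f z) / (w - z) - l)%C
          with ((f w - f z - (w - z) * l) / (w - z))%C by (field; auto).
        rewrite Cmod_div; auto.
        apply Rle_lt_trans with (eps / 2); [|lra].
        apply Rle_div_l; auto.
  - intros [q [H1 [<- H3]]] eps He.
    destruct (H3 eps He) as [d [Hd H]].
    exists d; split; auto. intros w Hw.
    rewrite (H1 w).
    replace (f z + (w - z) * q w - f z - (w - z) * q z)%C
      with ((q w - q z) * (w - z))%C by ring.
    rewrite Cmod_mult. apply Rmult_le_compat_r; [apply Cmod_ge_0|].
    left; auto.
Qed.

Lemma cdiff_ccont (f : C -> C) (z l : C) : cdiff f z l -> ccont f z.
Proof.
  intros H. apply cdiff_slope in H. destruct H as [q [H1 [H2 H3]]].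
  assert (H : ccont (fun w => f z + (w + - z) * q w)%C z)
    by (repeat first [apply ccont_plus | apply ccont_mult | apply ccont_const
                     | apply ccont_id | assumption]).
  intros eps He. destruct (H eps He) as [d [Hd Hd']].
  exists d; split; auto. intros w Hw. 
  replace (f w - f z)%C
    with (f z + (w + - z) * q w - (f z + (z + - z) * q z))%C
    by (rewrite (H1 w); ring).
  apply Hd'; auto.
Qed.

Lemma cdiff_const (c z : C) : cdiff (fun _ => c) z 0.
Proof.
  apply cdiff_slope. exists (fun _ => RtoC 0).
  split; [intros; ring | split; [reflexivity | apply ccont_const]].
Qed.

Lemma cdiff_id (z : C) : cdiff (fun w => w) z 1.
Proof.
  apply cdiff_slope. exists (fun _ => RtoC 1).
  split; [intros; ring | split; [reflexivity | apply ccont_const]].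
Qed.

Lemma cdiff_plus (f g : C -> C) (z l m : C) :
  cdiff f z l -> cdiff g z m -> cdiff (fun w => f w + g w)%C z (l + m)%C.
Proof.
  rewrite !cdiff_slope. intros [q [H1 [<- H3]]] [p [G1 [<- G3]]].
  exists (fun w => q w + p w)%C. split; [|split; [reflexivity|]].
  - intros w. rewrite (H1 w), (G1 w). ring.
  - apply ccont_plus; auto.
Qed.

Lemma cdiff_mult (f g : C -> C) (z l m : C) :
  cdiff f z l -> cdiff g z m ->
  cdiff (fun w => f w * g w)%C z (l * g z + f z * m)%C.
Proof.
  intros Hf Hg. pose proof (cdiff_ccont _ _ _ Hg) as Cg.
  revert Hf Hg. rewrite !cdiff_slope. intros [q [H1 [<- H3]]] [p [G1 [<- G3]]].
  exists (fun w => q w * g w + f z * p w)%C. split; [|split; [reflexivity|]].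
  - intros w. rewrite (H1 w). rewrite (G1 w). ring.
  - apply ccont_plus; apply ccont_mult; auto using ccont_const.
Qed.

Lemma cdiff_comp (f g : C -> C) (z l m : C) :
  cdiff f z l -> cdiff g (f z) m -> cdiff (fun w => g (f w)) z (l * m)%C.
Proof.
  intros Hf Hg. pose proof (cdiff_ccont _ _ _ Hf) as Cf.
  revert Hf Hg. rewrite !cdiff_slope. intros [q [H1 [<- H3]]] [p [G1 [<- G3]]].
  exists (fun w => q w * p (f w))%C. split; [|split; [reflexivity|]].
  - intros w. rewrite (G1 (f w)) at 1. rewrite (H1 w) at 1. ring.
  - apply ccont_mult; auto. apply ccont_comp; auto.
Qed.

Lemma cdiff_ext_ball (f g : C -> C) (z l : C) (r : R) :
  0 < r -> (forall w, Cmod (w - z)%C < r -> f w = g w) ->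
  cdiff f z l -> cdiff g z l.
Proof.
  intros Hr E H eps He. destruct (H eps He) as [d [Hd Hd']].
  exists (Rmin d r); split; [apply Rmin_pos; auto|].
  intros w Hw.
  pose proof (Rmin_l d r); pose proof (Rmin_r d r).
  rewrite <- !E; [apply Hd'; lra| |lra].
  replace (z - z)%C with (RtoC 0) by ring. rewrite Cmod_0; lra.
Qed.

Lemma cdiff_quadratic (f : C -> C) (z l : C) (r K : R) :
  0 < r ->
  (forall w, Cmod (w - z)%C < r ->
     Cmod (f w - f z - (w - z) * l)%C <= K * Cmod (w - z)%C ^ 2) ->
  cdiff f z l.
Proof.
  intros Hr H eps He.
  pose proof (Rabs_pos K) as PK.
  exists (Rmin r (eps / (Rabs K + 1))).
  split; [apply Rmin_pos; [auto|apply Rdiv_lt_0_compat; lra]|].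
  intros w Hw.
  pose proof (Rmin_l r (eps / (Rabs K + 1))).
  pose proof (Rmin_r r (eps / (Rabs K + 1))).
  pose proof (Cmod_ge_0 (w - z)%C) as P.
  eapply Rle_trans; [apply H; lra|].
  replace (K * Cmod (w - z)%C ^ 2) with (K * Cmod (w - z)%C * Cmod (w - z)%C) by ring.
  apply Rmult_le_compat_r; auto.
  assert (Q : Cmod (w - z)%C * (Rabs K + 1) <= eps).
  { apply Rle_div_r; lra. }
  pose proof (Rle_abs K). nra.
Qed.

Lemma cdiff_inv (z : C) : z <> 0 -> cdiff Cinv z (- / (z * z))%C.
Proof.
  intros Hz. assert (P : 0 < Cmod z) by (apply Cmod_gt_0; auto).
  apply (cdiff_quadratic _ _ _ (Cmod z / 2) (2 / Cmod z ^ 3)); [lra|].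
  intros w Hw.
  assert (Pw : Cmod z / 2 <= Cmod w).
  { pose proof (Cmod_ge_sub z w). rewrite Cmod_sub_sym in Hw. lra. }
  assert (Hw0 : w <> 0) by (apply Cmod_gt_0; lra).
  replace (/ w - / z - (w - z) * - / (z * z))%C
    with ((w - z) * (w - z) / (w * (z * z)))%C by (field; auto).
  rewrite Cmod_div by (repeat apply Cmult_neq_0; auto).
  rewrite !Cmod_mult.
  replace (Cmod (w - z)%C * Cmod (w - z)%C) with (Cmod (w - z)%C ^ 2) by ring.
  unfold Rdiv at 1. rewrite Rmult_comm.
  apply Rmult_le_compat_r; [apply pow2_ge_0|].
  replace (2 / Cmod z ^ 3) with (/ (Cmod z / 2 * (Cmod z * Cmod z))) by (field; lra).
  assert (0 < Cmod z * Cmod z) by nra.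
  apply Rinv_le_contravar; nra.
Qed.

Lemma cdiff_div (f g : C -> C) (z l m : C) :
  cdiff f z l -> cdiff g z m -> g z <> 0 ->
  cdiff (fun w => f w / g w)%C z ((l * g z - f z * m) / (g z * g z))%C.
Proof.
  intros Hf Hg N.
  replace ((l * g z - f z * m) / (g z * g z))%C
    with (l * / g z + f z * (m * - / (g z * g z)))%C by (field; auto).
  apply (cdiff_mult f (fun w => / g w)%C); auto.
  apply (cdiff_comp g Cinv); auto. apply cdiff_inv; auto.
Qed.

(** * Paths in the plane and their integrals *)

(** Paths are treated componentwise, so that limits, derivatives and integrals
    come from the calculus of real functions. *)
Definition pcont (g : R -> C) (t : R) : Prop :=
  continuous (fun s => Re (g s)) t /\ continuous (fun s => Im (g s)) t.

Definition pderiv (g : R -> C) (t : R) (l : C) : Prop :=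
  is_derive (fun s => Re (g s)) t (Re l) /\
  is_derive (fun s => Im (g s)) t (Im l).

Definition is_CInt (g : R -> C) (a b : R) (I : C) : Prop :=
  is_RInt (fun s => Re (g s)) a b (Re I) /\
  is_RInt (fun s => Im (g s)) a b (Im I).

Definition CInt (g : R -> C) (a b : R) : C :=
  (RInt (fun s => Re (g s)) a b, RInt (fun s => Im (g s)) a b).

Lemma continuous_eps (g : R -> R) (t : R) :
  continuous g t <->
  forall eps, 0 < eps -> exists delta, 0 < delta /\
    forall s, Rabs (s - t) < delta -> Rabs (g s - g t) < eps.
Proof.
  split.
  - intros H eps He.
    destruct (proj1 (filterlim_locally _ _) H (mkposreal eps He)) as [d Hd].
    exists d; split; [apply cond_pos|]. intros s Hs. apply (Hd s Hs).
  - intros H. apply filterlim_locally. intros eps.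
    destruct (H eps (cond_pos eps)) as [d [Hd Hd']].
    exists (mkposreal d Hd). intros s Hs. apply (Hd' s Hs).
Qed.

Lemma is_derive_eps (g : R -> R) (t l : R) :
  is_derive g t l <->
  forall eps, 0 < eps -> exists delta, 0 < delta /\
    forall s, Rabs (s - t) < delta ->
      Rabs (g s - g t - (s - t) * l) <= eps * Rabs (s - t).
Proof.
  split.
  - intros [_ H] eps He.
    destruct (H t (fun P HP => HP) (mkposreal eps He)) as [d Hd].
    exists d; split; [apply cond_pos|]. intros s Hs. exact (Hd s Hs).
  - intros H. split; [apply is_linear_scal_l|].
    intros x Hx eps.
    assert (E : t = x) by (apply is_filter_lim_locally_unique; exact Hx).
    subst x. destruct (H eps (cond_pos eps)) as [d [Hd Hd']].
    exists (mkposreal d Hd). intros s Hs. exact (Hd' s Hs).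
Qed.

Lemma pcont_eps (g : R -> C) (t : R) :
  pcont g t <->
  forall eps, 0 < eps -> exists delta, 0 < delta /\
    forall s, Rabs (s - t) < delta -> Cmod (g s - g t)%C < eps.
Proof.
  unfold pcont; rewrite !continuous_eps. split.
  - intros [H1 H2] eps He.
    destruct (H1 (eps / 2)) as [d1 [Hd1 D1]]; [lra|].
    destruct (H2 (eps / 2)) as [d2 [Hd2 D2]]; [lra|].
    exists (Rmin d1 d2); split; [apply Rmin_pos; auto|].
    intros s Hs. pose proof (Rmin_l d1 d2); pose proof (Rmin_r d1 d2).
    eapply Rle_lt_trans; [apply Cmod_le_ReIm|].
    specialize (D1 s ltac:(lra)); specialize (D2 s ltac:(lra)).
    unfold Re, Im in *; simpl. unfold Rminus in *. lra.
  - intros H; split; intros eps He; destruct (H eps He) as [d [Hd D]];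
      exists d; split; auto; intros s Hs; specialize (D s Hs);
      eapply Rle_lt_trans; try exact D.
    + apply (re_le_Cmod (g s - g t)%C).
    + apply (im_le_Cmod (g s - g t)%C).
Qed.

Lemma pderiv_eps (g : R -> C) (t : R) (l : C) :
  pderiv g t l <->
  forall eps, 0 < eps -> exists delta, 0 < delta /\
    forall s, Rabs (s - t) < delta ->
      Cmod (g s - g t - RtoC (s - t) * l)%C <= eps * Rabs (s - t).
Proof.
  unfold pderiv; rewrite !is_derive_eps. split.
  - intros [H1 H2] eps He.
    destruct (H1 (eps / 2)) as [d1 [Hd1 D1]]; [lra|].
    destruct (H2 (eps / 2)) as [d2 [Hd2 D2]]; [lra|].
    exists (Rmin d1 d2); split; [apply Rmin_pos; auto|].
    intros s Hs. pose proof (Rmin_l d1 d2); pose proof (Rmin_r d1 d2).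
    eapply Rle_trans; [apply Cmod_le_ReIm|].
    specialize (D1 s ltac:(lra)); specialize (D2 s ltac:(lra)).
    replace (Re (g s - g t - RtoC (s - t) * l)%C)
      with (Re (g s) - Re (g t) - (s - t) * Re l)
      by (unfold Re, Im; simpl; ring).
    replace (Im (g s - g t - RtoC (s - t) * l)%C)
      with (Im (g s) - Im (g t) - (s - t) * Im l)
      by (unfold Re, Im; simpl; ring).
    lra.
  - intros H; split; intros eps He; destruct (H eps He) as [d [Hd D]];
      exists d; split; auto; intros s Hs; specialize (D s Hs);
      eapply Rle_trans; try exact D.
    + replace (Re (g s) - Re (g t) - (s - t) * Re l)
        with (Re (g s - g t - RtoC (s - t) * l)%C)
        by (unfold Re, Im; simpl; ring).
      apply re_le_Cmod.
    + replace (Im (g s) - Im (g t) - (s - t) * Im l)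
        with (Im (g s - g t - RtoC (s - t) * l)%C)
        by (unfold Re, Im; simpl; ring).
      apply im_le_Cmod.
Qed.

Lemma pcont_const (c : C) (t : R) : pcont (fun _ => c) t.
Proof. split; apply continuous_const. Qed.

Lemma pcont_RtoC (g : R -> R) (t : R) :
  continuous g t -> pcont (fun s => RtoC (g s)) t.
Proof. intros H; split; [exact H | apply (continuous_const 0)]. Qed.

Lemma pcont_plus (f g : R -> C) (t : R) :
  pcont f t -> pcont g t -> pcont (fun s => f s + g s)%C t.
Proof.
  intros [F1 F2] [G1 G2]; split.
  - apply (continuous_plus (fun s => Re (f s)) (fun s => Re (g s))); auto.
  - apply (continuous_plus (fun s => Im (f s)) (fun s => Im (g s))); auto.
Qed.

Lemma pcont_mult (f g : R -> C) (t : R) :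
  pcont f t -> pcont g t -> pcont (fun s => f s * g s)%C t.
Proof.
  intros [F1 F2] [G1 G2]; split.
  - apply (continuous_minus (fun s => Re (f s) * Re (g s))
                            (fun s => Im (f s) * Im (g s)));
      apply (continuous_mult (K := R_AbsRing)); auto.
  - apply (continuous_plus (fun s => Re (f s) * Im (g s))
                           (fun s => Im (f s) * Re (g s)));
      apply (continuous_mult (K := R_AbsRing)); auto.
Qed.

Lemma pcont_comp (f : C -> C) (g : R -> C) (t : R) :
  pcont g t -> ccont f (g t) -> pcont (fun s => f (g s)) t.
Proof.
  rewrite !pcont_eps. intros Hg Hf eps He.
  destruct (Hf eps He) as [d [Hd D]]. destruct (Hg d Hd) as [d' [Hd' D']].
  exists d'; split; auto.
Qed.

Lemma pcont_div (f g : R -> C) (t : R) :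
  pcont f t -> pcont g t -> g t <> 0 -> pcont (fun s => f s / g s)%C t.
Proof.
  intros Hf Hg N. apply pcont_mult; auto.
  apply (pcont_comp Cinv g); auto. eapply cdiff_ccont, cdiff_inv; auto.
Qed.

Lemma pcont_conj (f : R -> C) (t : R) :
  pcont f t -> pcont (fun s => Cconj (f s)) t.
Proof.
  intros [F1 F2]; split; [exact F1|].
  apply (continuous_opp (fun s => Im (f s))); auto.
Qed.

Lemma pderiv_pcont (g : R -> C) (t : R) (l : C) : pderiv g t l -> pcont g t.
Proof.
  intros [H1 H2]; split; apply (ex_derive_continuous (V := R_NormedModule));
    eexists; eauto.
Qed.

Lemma pderiv_comp (f : C -> C) (g : R -> C) (t : R) (l m : C) :
  pderiv g t m -> cdiff f (g t) l -> pderiv (fun s => f (g s)) t (m * l)%C.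
Proof.
  intros Hg Hf. pose proof (pderiv_pcont _ _ _ Hg) as Cg.
  apply cdiff_slope in Hf. destruct Hf as [q [H1 [<- H3]]].
  pose proof (pcont_comp q g t Cg H3) as Cq.
  rewrite pderiv_eps in *. rewrite pcont_eps in Cq.
  intros eps He.
  pose proof (Cmod_ge_0 (q (g t))) as Pq. pose proof (Cmod_ge_0 m) as Pm.
  set (K := Cmod (q (g t)) + Cmod m + 1).
  assert (HK : 0 < K) by (unfold K; lra).
  set (e := Rmin 1 (eps / (2 * K))).
  assert (He' : 0 < e) by (apply Rmin_pos; [lra|apply Rdiv_lt_0_compat; lra]).
  assert (e <= 1) by apply Rmin_l.
  assert (HeK : e * K <= eps / 2).
  { replace (eps / 2) with (eps / (2 * K) * K) by (field; lra).
    apply Rmult_le_compat_r; [lra|apply Rmin_r]. }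
  destruct (Hg e He') as [d1 [Hd1 D1]].
  destruct (Cq e He') as [d2 [Hd2 D2]].
  exists (Rmin d1 d2); split; [apply Rmin_pos; auto|].
  intros s Hs. pose proof (Rmin_l d1 d2); pose proof (Rmin_r d1 d2).
  specialize (D1 s ltac:(lra)); specialize (D2 s ltac:(lra)).
  rewrite (H1 (g s)).
  replace (f (g t) + (g s - g t) * q (g s) - f (g t)
           - RtoC (s - t) * (m * q (g t)))%C
    with ((g s - g t - RtoC (s - t) * m) * q (g t)
          + ((g s - g t - RtoC (s - t) * m) * (q (g s) - q (g t))
             + RtoC (s - t) * m * (q (g s) - q (g t))))%C by ring.
  eapply Rle_trans; [apply Cmod_triangle|].
  eapply Rle_trans; [apply Rplus_le_compat_l, Cmod_triangle|].
  rewrite !Cmod_mult, Cmod_R.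
  set (A := Cmod (g s - g t - RtoC (s - t) * m)%C) in *.
  set (B := Cmod (q (g s) - q (g t))%C) in *.
  assert (0 <= A) by apply Cmod_ge_0. assert (0 <= B) by apply Cmod_ge_0.
  pose proof (Rabs_pos (s - t)).
  set (x := Rabs (s - t)) in *.
  assert (0 <= e * x) by (apply Rmult_le_pos; lra).
  assert (A * Cmod (q (g t)) <= e * x * Cmod (q (g t)))
    by (apply Rmult_le_compat_r; lra).
  assert (A * B <= e * x * 1) by (apply Rmult_le_compat; lra).
  assert (x * Cmod m * B <= x * Cmod m * e).
  { apply Rmult_le_compat_l; [apply Rmult_le_pos; lra|lra]. }
  assert (e * K * x <= eps / 2 * x) by (apply Rmult_le_compat_r; lra).
  unfold K in *. nra.
Qed.

Lemma pderiv_affine (a d : C) (t : R) : pderiv (fun s => a + RtoC s * d)%C t d.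
Proof.
  apply pderiv_eps. intros eps He. exists 1; split; [lra|]. intros s _.
  replace (a + s * d - (a + t * d) - RtoC (s - t) * d)%C with (RtoC 0)
    by (rewrite RtoC_minus; ring).
  rewrite Cmod_0. apply Rmult_le_pos; [lra|apply Rabs_pos].
Qed.

Lemma pderiv_scal (c : C) (g : R -> C) (t : R) (l : C) :
  pderiv g t l -> pderiv (fun s => c * g s)%C t (l * c)%C.
Proof.
  intros H. apply (pderiv_comp (fun w => c * w)%C g); auto.
  apply cdiff_slope. exists (fun _ => c).
  split; [intros; ring | split; [reflexivity | apply ccont_const]].
Qed.

Lemma is_CInt_unique (g : R -> C) (a b : R) (I : C) :
  is_CInt g a b I -> CInt g a b = I.
Proof.
  intros [H1 H2]. apply C_ext.
  - apply (is_RInt_unique (V := R_CompleteNormedModule)) in H1; exact H1.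
  - apply (is_RInt_unique (V := R_CompleteNormedModule)) in H2; exact H2.
Qed.

Lemma is_CInt_CInt (g : R -> C) (a b : R) :
  a <= b -> (forall t, a <= t <= b -> pcont g t) -> is_CInt g a b (CInt g a b).
Proof.
  intros Hab H. split; apply (RInt_correct (V := R_CompleteNormedModule));
    apply (ex_RInt_continuous (V := R_CompleteNormedModule));
    rewrite Rmin_left, Rmax_right by auto; intros t Ht; apply H; auto.
Qed.

Lemma is_CInt_ext (f g : R -> C) (a b : R) (I : C) :
  a <= b -> (forall t, a <= t <= b -> f t = g t) ->
  is_CInt f a b I -> is_CInt g a b I.
Proof.
  intros Hab E [H1 H2]; split;
    (eapply is_RInt_ext; [|eassumption]);
    rewrite Rmin_left, Rmax_right by auto; intros t Ht;
    rewrite E; auto; lra.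
Qed.

Lemma is_CInt_plus (f g : R -> C) (a b : R) (I J : C) :
  is_CInt f a b I -> is_CInt g a b J ->
  is_CInt (fun t => f t + g t)%C a b (I + J)%C.
Proof.
  intros [F1 F2] [G1 G2]; split.
  - apply (is_RInt_plus (fun s => Re (f s)) (fun s => Re (g s))); auto.
  - apply (is_RInt_plus (fun s => Im (f s)) (fun s => Im (g s))); auto.
Qed.

Lemma is_CInt_scal (c : C) (g : R -> C) (a b : R) (I : C) :
  is_CInt g a b I -> is_CInt (fun t => c * g t)%C a b (c * I)%C.
Proof.
  intros [G1 G2]; split.
  - apply (is_RInt_minus (fun s => Re c * Re (g s)) (fun s => Im c * Im (g s)) _ _
             (Re c * Re I) (Im c * Im I));
      apply (is_RInt_scal (V := R_NormedModule)); auto.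
  - apply (is_RInt_plus (fun s => Re c * Im (g s)) (fun s => Im c * Re (g s)) _ _
             (Re c * Im I) (Im c * Re I));
      apply (is_RInt_scal (V := R_NormedModule)); auto.
Qed.

Lemma is_CInt_minus (f g : R -> C) (a b : R) (I J : C) :
  is_CInt f a b I -> is_CInt g a b J ->
  is_CInt (fun t => f t - g t)%C a b (I - J)%C.
Proof.
  intros [F1 F2] [G1 G2]; split.
  - apply (is_RInt_minus (fun s => Re (f s)) (fun s => Re (g s))); auto.
  - apply (is_RInt_minus (fun s => Im (f s)) (fun s => Im (g s))); auto.
Qed.

Lemma is_CInt_conj (g : R -> C) (a b : R) (I : C) :
  is_CInt g a b I -> is_CInt (fun t => Cconj (g t)) a b (Cconj I).
Proof.
  intros [G1 G2]; split; [exact G1|].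
  apply (is_RInt_opp (fun s => Im (g s))); auto.
Qed.

Lemma is_CInt_const (c : C) (a b : R) :
  is_CInt (fun _ => c) a b (RtoC (b - a) * c)%C.
Proof.
  split.
  - replace (Re (RtoC (b - a) * c)%C) with (scal (b - a) (Re c))
      by (unfold Re, scal; simpl; unfold mult; simpl; ring).
    apply (is_RInt_const (V := R_NormedModule)).
  - replace (Im (RtoC (b - a) * c)%C) with (scal (b - a) (Im c))
      by (unfold Im, scal; simpl; unfold mult; simpl; ring).
    apply (is_RInt_const (V := R_NormedModule)).
Qed.

Lemma is_CInt_Chasles (g : R -> C) (a b c : R) (I J : C) :
  is_CInt g a b I -> is_CInt g b c J -> is_CInt g a c (I + J)%C.
Proof.
  intros [F1 F2] [G1 G2]; split;
    eapply (is_RInt_Chasles (V := R_NormedModule)); eauto.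
Qed.

Lemma is_CInt_pderiv (g dg : R -> C) (a b : R) :
  a <= b -> (forall t, a <= t <= b -> pderiv g t (dg t)) ->
  (forall t, a <= t <= b -> pcont dg t) ->
  is_CInt dg a b (g b - g a)%C.
Proof.
  intros Hab H1 H2; split.
  - apply (is_RInt_derive (V := R_CompleteNormedModule) (fun s => Re (g s)));
      rewrite Rmin_left, Rmax_right by auto; intros t Ht; [apply H1|apply H2]; auto.
  - apply (is_RInt_derive (V := R_CompleteNormedModule) (fun s => Im (g s)));
      rewrite Rmin_left, Rmax_right by auto; intros t Ht; [apply H1|apply H2]; auto.
Qed.

(** Rotating by the argument of the integral turns its modulus into the
    integral of a real part. *)
Lemma is_CInt_Cmod_le (f : R -> C) (g : R -> R) (a b : R) (I : C) (J : R) :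
  a <= b -> is_CInt f a b I -> is_RInt g a b J ->
  (forall t, a <= t <= b -> Cmod (f t) <= g t) -> Cmod I <= J.
Proof.
  intros Hab HI HJ H.
  destruct (Ceq_dec I 0) as [->|N].
  - rewrite Cmod_0.
    eapply is_RInt_le; [exact Hab| | exact HJ |].
    + replace 0 with (scal (b - a) 0) by (apply Rmult_0_r).
      apply (is_RInt_const (V := R_NormedModule) a b 0).
    + intros t Ht. simpl. eapply Rle_trans; [apply Cmod_ge_0|apply H; lra].
  - assert (P : 0 < Cmod I) by (apply Cmod_gt_0; auto).
    destruct (is_CInt_scal (Cconj I / RtoC (Cmod I))%C _ _ _ _ HI) as [Hre _].
    replace (Re (Cconj I / RtoC (Cmod I) * I)%C) with (Cmod I) in Hre.
    + eapply is_RInt_le; [exact Hab | exact Hre | exact HJ |].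
      intros t Ht. cbv beta.
      eapply Rle_trans; [apply Rle_abs|].
      eapply Rle_trans; [apply re_le_Cmod|].
      rewrite Cmod_mult, Cmod_div, Cmod_conj, Cmod_R, Rabs_right
        by (first [lra | intro E; apply RtoC_inj in E; lra]).
      replace (Cmod I / Cmod I) with 1 by (field; lra).
      rewrite Rmult_1_l. apply H; lra.
    + assert (E : (Cconj I / RtoC (Cmod I) * I)%C = RtoC (Cmod I)).
      { replace (Cconj I / RtoC (Cmod I) * I)%C
          with (I * Cconj I / RtoC (Cmod I))%C.
        - rewrite <- Cmod2_conj. simpl. rewrite !RtoC_mult. field.
          intro E; apply RtoC_inj in E; lra.
        - field. intro E; apply RtoC_inj in E; lra. }
      rewrite E. reflexivity.
Qed.

Lemma is_CInt_Cmod_le_const (f : R -> C) (K a b : R) (I : C) :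
  a <= b -> is_CInt f a b I ->
  (forall t, a <= t <= b -> Cmod (f t) <= K) -> Cmod I <= (b - a) * K.
Proof.
  intros Hab HI H.
  apply (is_CInt_Cmod_le f (fun _ => K) a b I); auto.
  apply (is_RInt_const (V := R_NormedModule) a b K).
Qed.

(** * Goursat's bisection argument *)

Lemma nested_intervals (a b : nat -> R) :
  (forall n, a n <= a (S n)) -> (forall n, b (S n) <= b n) ->
  (forall n, a n <= b n) -> exists x, forall n, a n <= x <= b n.
Proof.
  intros Ha Hb Hab.
  assert (Ma : forall n k, a n <= a (n + k)%nat).
  { intros n k; induction k as [|k IH]; [rewrite Nat.add_0_r; lra|].
    rewrite Nat.add_succ_r. specialize (Ha (n + k)%nat). lra. }
  assert (Mb : forall n k, b (n + k)%nat <= b n).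
  { intros n k; induction k as [|k IH]; [rewrite Nat.add_0_r; lra|].
    rewrite Nat.add_succ_r. specialize (Hb (n + k)%nat). lra. }
  assert (H : forall n m, a n <= b m).
  { intros n m. specialize (Ma n m). specialize (Mb m n).
    rewrite Nat.add_comm in Mb. specialize (Hab (n + m)%nat). lra. }
  destruct (completeness (fun x => exists n, x = a n)) as [x [Hx1 Hx2]].
  - exists (b 0%nat). intros y [n ->]. apply H.
  - exists (a 0%nat). exists 0%nat; reflexivity.
  - exists x. intros n; split.
    + apply Hx1. exists n; reflexivity.
    + apply Hx2. intros y [m ->]. apply H.
Qed.

(** Goursat's argument for an arbitrary rectangle function: a rectangle whose
    value is too large compared with its squared size has a quarter with the
    same defect, and the nested quarters contradict the local estimate at their
    common point. *)
Lemma additive_rectangle_function_zero (Phi : R -> R -> R -> R -> C)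
    (a0 b0 c0 d0 : R) :
  a0 <= b0 -> c0 <= d0 ->
  (forall a m b c d, a0 <= a <= m -> m <= b <= b0 -> c0 <= c <= d -> d <= d0 ->
     Phi a b c d = (Phi a m c d + Phi m b c d)%C) ->
  (forall a b c k d, a0 <= a <= b -> b <= b0 -> c0 <= c <= k -> k <= d <= d0 ->
     Phi a b c d = (Phi a b c k + Phi a b k d)%C) ->
  (forall x y eps, a0 <= x <= b0 -> c0 <= y <= d0 -> 0 < eps ->
     exists delta, 0 < delta /\
       forall a b c d, a0 <= a <= x -> x <= b <= b0 -> c0 <= c <= y ->
         y <= d <= d0 -> (b - a) + (d - c) < delta ->
         Cmod (Phi a b c d) <= eps * ((b - a) + (d - c)) ^ 2) ->
  Phi a0 b0 c0 d0 = 0.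
Proof.
  intros Hab Hcd Hx Hy Hloc.
  destruct (Ceq_dec (Phi a0 b0 c0 d0) 0) as [E|N]; [exact E|exfalso].
  assert (P : 0 < Cmod (Phi a0 b0 c0 d0)) by (apply Cmod_gt_0; auto).
  set (s0 := (b0 - a0) + (d0 - c0)).
  assert (Hs0 : 0 <= s0) by (unfold s0; lra).
  set (eps := Cmod (Phi a0 b0 c0 d0) / (2 * (s0 ^ 2 + 1))).
  assert (Q0 : 0 < s0 ^ 2 + 1) by (pose proof (pow2_ge_0 s0); lra).
  assert (He : 0 < eps) by (apply Rdiv_lt_0_compat; lra).
  assert (Hbad0 : eps * s0 ^ 2 < Cmod (Phi a0 b0 c0 d0)).
  { assert (E : eps * (2 * (s0 ^ 2 + 1)) = Cmod (Phi a0 b0 c0 d0))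
      by (unfold eps; field; lra).
    pose proof (pow2_ge_0 s0). nra. }
  set (bad := fun a b c d => eps * ((b - a) + (d - c)) ^ 2 < Cmod (Phi a b c d)).
  assert (bad_dec : forall a b c d, {bad a b c d} + {~ bad a b c d})
    by (intros; apply Rlt_dec).
  pose (step := fun q : (R * R) * (R * R) =>
    let a := fst (fst q) in let b := snd (fst q) in
    let c := fst (snd q) in let d := snd (snd q) in
    let m := (a + b) / 2 in let k := (c + d) / 2 in
    if bad_dec a m c k then ((a, m), (c, k)) else
    if bad_dec m b c k then ((m, b), (c, k)) else
    if bad_dec a m k d then ((a, m), (k, d)) else ((m, b), (k, d))).
  pose (good := fun q : (R * R) * (R * R) =>
    a0 <= fst (fst q) /\ fst (fst q) <= snd (fst q) /\ snd (fst q) <= b0 /\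
    c0 <= fst (snd q) /\ fst (snd q) <= snd (snd q) /\ snd (snd q) <= d0 /\
    bad (fst (fst q)) (snd (fst q)) (fst (snd q)) (snd (snd q))).
  assert (Hstep : forall q, good q -> good (step q) /\
    fst (fst q) <= fst (fst (step q)) /\ snd (fst (step q)) <= snd (fst q) /\
    fst (snd q) <= fst (snd (step q)) /\ snd (snd (step q)) <= snd (snd q) /\
    snd (fst (step q)) - fst (fst (step q)) = (snd (fst q) - fst (fst q)) / 2 /\
    snd (snd (step q)) - fst (snd (step q)) = (snd (snd q) - fst (snd q)) / 2).
  { intros [[a b] [c d]]. unfold good; simpl. intros (h1 & h2 & h3 & h4 & h5 & h6 & h7).
    unfold step; simpl.
    set (m := (a + b) / 2). set (k := (c + d) / 2).
    assert (a <= m <= b) by (unfold m; lra). assert (c <= k <= d) by (unfold k; lra).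
    assert (m - a = (b - a) / 2) by (unfold m; lra).
    assert (b - m = (b - a) / 2) by (unfold m; lra).
    assert (k - c = (d - c) / 2) by (unfold k; lra).
    assert (d - k = (d - c) / 2) by (unfold k; lra).
    destruct (bad_dec a m c k) as [B1|B1]; [simpl; repeat split; auto; lra|].
    destruct (bad_dec m b c k) as [B2|B2]; [simpl; repeat split; auto; lra|].
    destruct (bad_dec a m k d) as [B3|B3]; [simpl; repeat split; auto; lra|].
    simpl. repeat split; try lra.
    unfold bad in *. apply Rnot_lt_le in B1, B2, B3. apply Rnot_le_lt; intro B4.
    assert (E : Phi a b c d
      = ((Phi a m c k + Phi m b c k) + (Phi a m k d + Phi m b k d))%C).
    { rewrite (Hy a b c k d), (Hx a m b c k), (Hx a m b k d) by lra. reflexivity. }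
    rewrite E in h7. clear E.
    pose proof (Cmod_triangle (Phi a m c k + Phi m b c k)%C (Phi a m k d + Phi m b k d)%C).
    pose proof (Cmod_triangle (Phi a m c k) (Phi m b c k)).
    pose proof (Cmod_triangle (Phi a m k d) (Phi m b k d)).
    replace (m - a + (k - c)) with (((b - a) + (d - c)) / 2) in B1 by lra.
    replace (b - m + (k - c)) with (((b - a) + (d - c)) / 2) in B2 by lra.
    replace (m - a + (d - k)) with (((b - a) + (d - c)) / 2) in B3 by lra.
    replace (b - m + (d - k)) with (((b - a) + (d - c)) / 2) in B4 by lra.
    assert (eps * (((b - a) + (d - c)) / 2) ^ 2 = eps * ((b - a) + (d - c)) ^ 2 / 4)
      by field.
    lra. }
  pose (q := fun n => Nat.iter n step ((a0, b0), (c0, d0))).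
  assert (Hq : forall n, good (q n)).
  { induction n as [|n IH]; [|apply Hstep; exact IH].
    unfold good; simpl. repeat split; try lra. exact Hbad0. }
  assert (Hsize : forall n,
    (snd (fst (q n)) - fst (fst (q n))) + (snd (snd (q n)) - fst (snd (q n)))
    = s0 * (/ 2) ^ n).
  { induction n as [|n IH]; [simpl; unfold s0; ring|].
    destruct (Hstep (q n) (Hq n)) as (_ & _ & _ & _ & _ & E1 & E2).
    change (q (S n)) with (step (q n)). rewrite E1, E2. simpl. lra. }
  destruct (nested_intervals (fun n => fst (fst (q n))) (fun n => snd (fst (q n))))
    as [x Hxq]; try (intro n; apply (Hstep (q n) (Hq n))); [intro n; apply (Hq n)|].
  destruct (nested_intervals (fun n => fst (snd (q n))) (fun n => snd (snd (q n))))
    as [y Hyq]; try (intro n; apply (Hstep (q n) (Hq n))); [intro n; apply (Hq n)|].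
  destruct (Hloc x y eps) as [delta [Hd Hlim]]; auto.
  { apply (Hxq 0%nat). } { apply (Hyq 0%nat). }
  destruct (pow_lt_1_zero (/ 2)) with (y := delta / (s0 + 1)) as [n Hn].
  { rewrite Rabs_right; lra. }
  { apply Rdiv_lt_0_compat; lra. }
  specialize (Hn n (Nat.le_refl n)).
  destruct (Hq n) as (h1 & h2 & h3 & h4 & h5 & h6 & h7).
  specialize (Hxq n). specialize (Hyq n).
  apply Rlt_not_le in h7. apply h7. apply Hlim; try lra.
  rewrite Hsize.
  assert (0 < (/ 2) ^ n) by (apply pow_lt; lra).
  rewrite Rabs_right in Hn by lra.
  assert ((/ 2) ^ n * (s0 + 1) < delta).
  { apply Rlt_div_r in Hn; lra. }
  lra.
Qed.

(** * The Cauchy integral formula *)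

Definition cis (t : R) : C := (cos t, sin t).

Lemma Cmod_cis (t : R) : Cmod (cis t) = 1.
Proof.
  unfold Cmod, cis; simpl.
  replace (cos t * (cos t * 1) + sin t * (sin t * 1)) with (Rsqr (sin t) + Rsqr (cos t))
    by (unfold Rsqr; ring).
  rewrite sin2_cos2. apply sqrt_1.
Qed.

Lemma cis_neq_0 (t : R) : cis t <> 0.
Proof. apply Cmod_gt_0. rewrite Cmod_cis; lra. Qed.

Lemma Cconj_cis (t : R) : Cconj (cis t) = (/ cis t)%C.
Proof.
  replace (/ cis t)%C with (cis t * Cconj (cis t) / cis t)%C.
  - field. apply cis_neq_0.
  - rewrite <- Cmod2_conj, Cmod_cis. replace (1 ^ 2) with 1 by ring. field.
    apply cis_neq_0.
Qed.

Lemma cis_0 : cis 0 = 1.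
Proof. unfold cis. rewrite cos_0, sin_0. reflexivity. Qed.

Lemma cis_2PI : cis (2 * PI) = 1.
Proof. unfold cis. rewrite cos_2PI, sin_2PI. reflexivity. Qed.

Lemma pderiv_cis (t : R) : pderiv cis t (Ci * cis t)%C.
Proof.
  split; unfold cis, Ci, Re, Im; simpl; auto_derive; auto; ring.
Qed.

Lemma pcont_cis (t : R) : pcont cis t.
Proof. eapply pderiv_pcont, pderiv_cis. Qed.

Lemma cis_lipschitz_le (s t : R) : s <= t -> Cmod (cis t - cis s)%C <= t - s.
Proof.
  intros Hst. rewrite <- (Rmult_1_r (t - s)).
  apply (is_CInt_Cmod_le_const (fun u => Ci * cis u)%C); auto.
  - apply is_CInt_pderiv; auto; intros; [apply pderiv_cis|].
    apply pcont_mult; [apply pcont_const | apply pcont_cis].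
  - intros. rewrite Cmod_mult, Cmod_Ci, Cmod_cis; lra.
Qed.

Lemma cis_lipschitz (s t : R) : Cmod (cis t - cis s)%C <= Rabs (t - s).
Proof.
  destruct (Rle_dec s t) as [H|H].
  - rewrite Rabs_right by lra. apply cis_lipschitz_le; auto.
  - rewrite Rabs_left by lra. rewrite Cmod_sub_sym.
    pose proof (cis_lipschitz_le t s ltac:(lra)); lra.
Qed.

Lemma exp_le (s t : R) : s <= t -> exp s <= exp t.
Proof. intros [H| ->]; [left; apply exp_increasing; auto | lra]. Qed.

Lemma exp_lipschitz_le (s t : R) : s <= t <= 0 -> exp t - exp s <= t - s.
Proof.
  intros H. replace s with (t + - (t - s)) at 1 by ring. rewrite exp_plus.
  pose proof (exp_ineq1_le (- (t - s))).
  pose proof (exp_pos t).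
  assert (exp t <= 1) by (rewrite <- exp_0; apply exp_le; lra).
  nra.
Qed.

Lemma exp_lipschitz (s t : R) :
  s <= 0 -> t <= 0 -> Rabs (exp t - exp s) <= Rabs (t - s).
Proof.
  intros Hs Ht. destruct (Rle_dec s t) as [H|H].
  - assert (exp s <= exp t) by (apply exp_le; auto).
    rewrite !Rabs_right by lra. apply exp_lipschitz_le; lra.
  - assert (exp t <= exp s) by (apply exp_le; lra).
    rewrite <- (Rabs_Ropp (exp t - _)), <- (Rabs_Ropp (t - s)), !Rabs_right by lra.
    pose proof (exp_lipschitz_le t s ltac:(lra)); lra.
Qed.

Definition ray (r : R) (z : C) (t : R) : C := (RtoC r * cis t - z)%C.

(** The coordinates [(s, t)] contract the circle of radius [r] onto the point
    [z] as [s] decreases from [0] to [-oo]; they turn [dw / (w - z)] into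
    [ds + Ci * cauchy_kernel r z t dt], where neither coefficient mixes the two
    coordinates. *)
Definition spoke (r : R) (z : C) (s t : R) : C :=
  (z + RtoC (exp s) * ray r z t)%C.

Definition cauchy_kernel (r : R) (z : C) (t : R) : C :=
  (RtoC r * cis t / ray r z t)%C.

(** The integral of [F w / (w - z) dw] along the boundary of the image of a
    coordinate rectangle. *)
Definition boundary_integral (r : R) (z : C) (F : C -> C) (a b c d : R) : C :=
  (CInt (fun s => F (spoke r z s c)) a b
   + CInt (fun t => Ci * (F (spoke r z b t) * cauchy_kernel r z t)) c d
   - CInt (fun s => F (spoke r z s d)) a b
   - CInt (fun t => Ci * (F (spoke r z a t) * cauchy_kernel r z t)) c d)%C.

Lemma Cmod_ray_ge (r : R) (z : C) (t : R) :
  0 < r -> r - Cmod z <= Cmod (ray r z t).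
Proof.
  intros Hr. pose proof (Cmod_ge_sub (RtoC r * cis t)%C z) as H.
  rewrite Cmod_mult, Cmod_R, Cmod_cis, Rabs_right in H by lra.
  unfold ray; lra.
Qed.

Lemma ray_neq_0 (r : R) (z : C) (t : R) : 0 < r -> Cmod z < r -> ray r z t <> 0.
Proof.
  intros Hr Hz. apply Cmod_gt_0. pose proof (Cmod_ray_ge r z t Hr); lra.
Qed.

Lemma Cmod_ray_le (r : R) (z : C) (t : R) :
  0 < r -> Cmod (ray r z t) <= r + Cmod z.
Proof.
  intros Hr. unfold ray. eapply Rle_trans; [apply Cmod_sub_triangle|].
  rewrite Cmod_mult, Cmod_R, Cmod_cis, Rabs_right by lra. lra.
Qed.

Lemma pderiv_ray (r : R) (z : C) (t : R) :
  pderiv (ray r z) t (RtoC r * (Ci * cis t))%C.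
Proof.
  replace (RtoC r * (Ci * cis t))%C with (Ci * cis t * RtoC r)%C by ring.
  destruct (pderiv_scal (RtoC r) cis t _ (pderiv_cis t)) as [H1 H2].
  split.
  - apply (is_derive_ext (fun s => Re (RtoC r * cis s)%C + - Re z)); [reflexivity|].
    rewrite <- (Rplus_0_r (Re (_ * _)%C)).
    apply (is_derive_plus (V := R_NormedModule)); [exact H1 | apply (is_derive_const (V := R_NormedModule))].
  - apply (is_derive_ext (fun s => Im (RtoC r * cis s)%C + - Im z)); [reflexivity|].
    rewrite <- (Rplus_0_r (Im (_ * _)%C)).
    apply (is_derive_plus (V := R_NormedModule)); [exact H2 | apply (is_derive_const (V := R_NormedModule))].
Qed.

Lemma pcont_ray (r : R) (z : C) (t : R) : pcont (ray r z) t.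
Proof. eapply pderiv_pcont, pderiv_ray. Qed.

Lemma pcont_kernel (r : R) (z : C) (t : R) :
  0 < r -> Cmod z < r -> pcont (cauchy_kernel r z) t.
Proof.
  intros Hr Hz. apply pcont_div; [|apply pcont_ray|apply ray_neq_0; auto].
  apply pcont_mult; [apply pcont_const | apply pcont_cis].
Qed.

Lemma Cmod_kernel_le (r : R) (z : C) (t : R) :
  0 < r -> Cmod z < r -> Cmod (cauchy_kernel r z t) <= r / (r - Cmod z).
Proof.
  intros Hr Hz. unfold cauchy_kernel.
  rewrite Cmod_div by (apply ray_neq_0; auto).
  rewrite Cmod_mult, Cmod_R, Cmod_cis, Rabs_right by lra.
  rewrite Rmult_1_r. apply Rmult_le_compat_l; [lra|].
  apply Rinv_le_contravar; [lra | apply Cmod_ray_ge; auto].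
Qed.

Lemma spoke_in_disk (r : R) (z : C) (s t : R) :
  0 < r < 1 -> Cmod z < r -> s <= 0 -> Cmod (spoke r z s t) < 1.
Proof.
  intros Hr Hz Hs.
  assert (E1 : exp s <= 1) by (rewrite <- exp_0; apply exp_le; lra).
  pose proof (exp_pos s) as E0.
  unfold spoke, ray.
  replace (z + exp s * (r * cis t - z))%C
    with (RtoC (1 - exp s) * z + RtoC (exp s) * (RtoC r * cis t))%C
    by (rewrite RtoC_minus; ring).
  eapply Rle_lt_trans; [apply Cmod_triangle|].
  rewrite !Cmod_mult, !Cmod_R, Cmod_cis, !Rabs_right by lra.
  pose proof (Cmod_ge_0 z). nra.
Qed.

Lemma spoke_lipschitz (r : R) (z : C) (s t s0 t0 : R) :
  0 < r < 1 -> Cmod z < r -> s <= 0 -> s0 <= 0 ->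
  Cmod (spoke r z s t - spoke r z s0 t0)%C <= 2 * (Rabs (s - s0) + Rabs (t - t0)).
Proof.
  intros Hr Hz Hs Hs0. unfold spoke.
  replace (z + exp s * ray r z t - (z + exp s0 * ray r z t0))%C
    with (RtoC (exp s - exp s0) * ray r z t
          + RtoC (exp s0) * (RtoC r * (cis t - cis t0)))%C
    by (unfold ray; rewrite RtoC_minus; ring).
  eapply Rle_trans; [apply Cmod_triangle|].
  pose proof (exp_pos s0).
  assert (exp s0 <= 1) by (rewrite <- exp_0; apply exp_le; lra).
  rewrite !Cmod_mult, !Cmod_R, (Rabs_right (exp s0)), (Rabs_right r) by lra.
  pose proof (exp_lipschitz s0 s Hs0 Hs). pose proof (cis_lipschitz t0 t).
  pose proof (Cmod_ray_le r z t ltac:(lra)). pose proof (Cmod_ge_0 (ray r z t)).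
  pose proof (Rabs_pos (exp s - exp s0)). pose proof (Cmod_ge_0 (cis t - cis t0)%C).
  assert (Rabs (exp s - exp s0) * Cmod (ray r z t) <= Rabs (s - s0) * 2)
    by (apply Rmult_le_compat; lra).
  assert (exp s0 * (r * Cmod (cis t - cis t0)%C) <= 1 * (1 * Rabs (t - t0))).
  { apply Rmult_le_compat; try lra; [apply Rmult_le_pos; lra|].
    apply Rmult_le_compat; lra. }
  pose proof (Rabs_pos (t - t0)). lra.
Qed.

Lemma pderiv_spoke_s (r : R) (z : C) (s t : R) :
  pderiv (fun u => spoke r z u t) s (RtoC (exp s) * ray r z t)%C.
Proof.
  split; unfold spoke, Re, Im; simpl; auto_derive; auto; ring.
Qed.

Lemma pcont_spoke_s (r : R) (z : C) (s t : R) : pcont (fun u => spoke r z u t) s.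
Proof. eapply pderiv_pcont, pderiv_spoke_s. Qed.

Lemma pcont_spoke_t (r : R) (z : C) (s t : R) : pcont (spoke r z s) t.
Proof.
  apply pcont_plus; [apply pcont_const|].
  apply pcont_mult; [apply pcont_const | apply pcont_ray].
Qed.

Definition ccont_in_disk (F : C -> C) : Prop := forall w, Cmod w < 1 -> ccont F w.

Lemma pcont_radial (r : R) (z : C) (F : C -> C) (s t : R) :
  0 < r < 1 -> Cmod z < r -> ccont_in_disk F -> s <= 0 ->
  pcont (fun u => F (spoke r z u t)) s.
Proof.
  intros Hr Hz HF Hs. apply (pcont_comp F (fun u => spoke r z u t)).
  - apply pcont_spoke_s.
  - apply HF, spoke_in_disk; auto.
Qed.

Lemma pcont_circular (r : R) (z : C) (F : C -> C) (s t : R) :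
  0 < r < 1 -> Cmod z < r -> ccont_in_disk F -> s <= 0 ->
  pcont (fun u => Ci * (F (spoke r z s u) * cauchy_kernel r z u))%C t.
Proof.
  intros Hr Hz HF Hs.
  apply pcont_mult; [apply pcont_const|].
  apply pcont_mult; [|apply pcont_kernel; lra].
  apply (pcont_comp F (spoke r z s)).
  - apply pcont_spoke_t.
  - apply HF, spoke_in_disk; auto.
Qed.

Lemma boundary_integral_minus (r : R) (z : C) (F G : C -> C) (a b c d : R) :
  0 < r < 1 -> Cmod z < r -> ccont_in_disk F -> ccont_in_disk G ->
  a <= b <= 0 -> c <= d ->
  boundary_integral r z (fun w => F w - G w)%C a b c d
  = (boundary_integral r z F a b c d - boundary_integral r z G a b c d)%C.
Proof.
  intros Hr Hz HF HG Hab Hcd.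
  assert (Hs : forall y,
    CInt (fun s => F (spoke r z s y) - G (spoke r z s y))%C a b
    = (CInt (fun s => F (spoke r z s y)) a b - CInt (fun s => G (spoke r z s y)) a b)%C).
  { intros y. apply is_CInt_unique, is_CInt_minus; apply is_CInt_CInt; try lra;
      intros; apply pcont_radial; auto; lra. }
  assert (Ht : forall x, x <= 0 ->
    CInt (fun t => Ci * ((F (spoke r z x t) - G (spoke r z x t)) * cauchy_kernel r z t))%C c d
    = (CInt (fun t => Ci * (F (spoke r z x t) * cauchy_kernel r z t))%C c d
       - CInt (fun t => Ci * (G (spoke r z x t) * cauchy_kernel r z t))%C c d)%C).
  { intros x Hx. apply is_CInt_unique.
    apply (is_CInt_ext (fun t => Ci * (F (spoke r z x t) * cauchy_kernel r z t)
                        - Ci * (G (spoke r z x t) * cauchy_kernel r z t))%C);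
      [auto | intros; ring |].
    apply is_CInt_minus; apply is_CInt_CInt; auto; intros;
      apply pcont_circular; auto. }
  unfold boundary_integral. rewrite !Hs, !Ht by lra. ring.
Qed.

Lemma boundary_integral_bound (r : R) (z : C) (F : C -> C) (a b c d E : R) :
  0 < r < 1 -> Cmod z < r -> ccont_in_disk F -> a <= b <= 0 -> c <= d ->
  (forall s t, a <= s <= b -> c <= t <= d -> Cmod (F (spoke r z s t)) <= E) ->
  Cmod (boundary_integral r z F a b c d)
  <= 2 * E / (r - Cmod z) * ((b - a) + (d - c)).
Proof.
  intros Hr Hz HF Hab Hcd HE.
  pose proof (Cmod_ge_0 z) as Pz.
  assert (PE : 0 <= E).
  { eapply Rle_trans; [apply Cmod_ge_0|apply (HE a c); lra]. }
  set (K := E / (r - Cmod z)).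
  assert (HK : E <= K).
  { apply Rle_div_r; [lra|]. nra. }
  assert (Hs : forall y, c <= y <= d ->
    Cmod (CInt (fun s => F (spoke r z s y)) a b) <= (b - a) * K).
  { intros y Hy. apply (is_CInt_Cmod_le_const (fun s => F (spoke r z s y))); [lra| |].
    - apply is_CInt_CInt; [lra|]. intros; apply pcont_radial; auto; lra.
    - intros s Hs. eapply Rle_trans; [apply HE; auto | exact HK]. }
  assert (Ht : forall x, a <= x <= b ->
    Cmod (CInt (fun t => Ci * (F (spoke r z x t) * cauchy_kernel r z t)) c d)%C
    <= (d - c) * K).
  { intros x Hx.
    apply (is_CInt_Cmod_le_const
      (fun t => Ci * (F (spoke r z x t) * cauchy_kernel r z t))%C); [lra| |].
    - apply is_CInt_CInt; [lra|]. intros; apply pcont_circular; auto; lra.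
    - intros t Ht. rewrite !Cmod_mult, Cmod_Ci, Rmult_1_l.
      apply Rle_trans with (E * (r / (r - Cmod z))).
      + apply Rmult_le_compat; try apply Cmod_ge_0; auto.
        apply Cmod_kernel_le; lra.
      + unfold K, Rdiv. rewrite <- Rmult_assoc.
        apply Rmult_le_compat_r; [left; apply Rinv_0_lt_compat; lra|]. nra. }
  unfold boundary_integral.
  pose proof (Hs c ltac:(lra)); pose proof (Hs d ltac:(lra)).
  pose proof (Ht a ltac:(lra)); pose proof (Ht b ltac:(lra)).
  replace (2 * E / (r - Cmod z) * (b - a + (d - c)))
    with ((b - a) * K + (d - c) * K + (b - a) * K + (d - c) * K)
    by (unfold K; field; lra).
  eapply Rle_trans; [apply Cmod_sub_triangle|]. apply Rplus_le_compat; [|assumption].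
  eapply Rle_trans; [apply Cmod_sub_triangle|]. apply Rplus_le_compat; [|assumption].
  eapply Rle_trans; [apply Cmod_triangle|]. apply Rplus_le_compat; assumption.
Qed.

(** The integrand is [alpha] times a form with separated variables plus [beta]
    times the exact form [d (spoke r z s t)]; both are closed. *)
Lemma boundary_integral_affine (r : R) (z alpha beta : C) (a b c d : R) :
  0 < r < 1 -> Cmod z < r -> a <= b -> c <= d ->
  boundary_integral r z (fun w => alpha + beta * (w - z))%C a b c d = 0.
Proof.
  intros Hr Hz Hab Hcd.
  assert (Hs : forall y,
    CInt (fun s => alpha + beta * (spoke r z s y - z))%C a b
    = (RtoC (b - a) * alpha + beta * (spoke r z b y - spoke r z a y))%C).
  { intros y. apply is_CInt_unique.
    apply (is_CInt_ext (fun s => alpha + beta * (RtoC (exp s) * ray r z y))%C);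
      [auto | intros; unfold spoke; ring |].
    apply is_CInt_plus; [apply is_CInt_const | apply is_CInt_scal].
    apply (is_CInt_pderiv (fun s => spoke r z s y)); auto.
    - intros; apply pderiv_spoke_s.
    - intros. apply pcont_mult; [|apply pcont_const]. apply pcont_RtoC.
      apply (ex_derive_continuous (V := R_NormedModule)). auto_derive; auto. }
  assert (Ht : forall x,
    CInt (fun t => Ci * ((alpha + beta * (spoke r z x t - z)) * cauchy_kernel r z t))%C c d
    = (alpha * (Ci * CInt (cauchy_kernel r z) c d)
       + beta * (RtoC (exp x) * (ray r z d - ray r z c)))%C).
  { intros x. apply is_CInt_unique.
    apply (is_CInt_ext (fun t => alpha * (Ci * cauchy_kernel r z t)
             + beta * (RtoC (exp x) * (RtoC r * (Ci * cis t))))%C); [auto | |].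
    - intros t _. unfold spoke, cauchy_kernel. field. apply ray_neq_0; lra.
    - apply is_CInt_plus; do 2 apply is_CInt_scal.
      + apply is_CInt_CInt; auto. intros; apply pcont_kernel; lra.
      + apply (is_CInt_pderiv (ray r z)); auto.
        * intros; apply pderiv_ray.
        * intros. do 2 (apply pcont_mult; [apply pcont_const|]). apply pcont_cis. }
  unfold boundary_integral. rewrite !Hs, !Ht. unfold spoke. ring.
Qed.

Definition holo (f : C -> C) : Prop :=
  forall w, Cmod w < 1 -> exists l, cdiff f w l.

Lemma holo_ccont (f : C -> C) : holo f -> ccont_in_disk f.
Proof. intros H w Hw. destruct (H w Hw) as [l Hl]. eapply cdiff_ccont; eauto. Qed.

(** To first order a differentiable integrand is affine, so only the remainder
    contributes to the integral around a small rectangle. *)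
Lemma boundary_integral_local (r : R) (z : C) (f : C -> C) (x y eps : R) :
  0 < r < 1 -> Cmod z < r -> holo f -> x <= 0 -> 0 < eps ->
  exists delta, 0 < delta /\
    forall a b c d, a <= x -> x <= b <= 0 -> c <= y -> y <= d ->
      (b - a) + (d - c) < delta ->
      Cmod (boundary_integral r z f a b c d) <= eps * ((b - a) + (d - c)) ^ 2.
Proof.
  intros Hr Hz Hf Hx He.
  pose proof (Cmod_ge_0 z) as Pz.
  set (zeta := spoke r z x y).
  assert (Hzeta : Cmod zeta < 1) by (apply spoke_in_disk; auto).
  destruct (Hf zeta Hzeta) as [l Hl].
  (* The bound on boundary integrals costs 2 / (r - |z|), and a rectangle of
     size s lies within 2 s of zeta. *)
  set (e := eps * (r - Cmod z) / 4).
  assert (He' : 0 < e) by (unfold e; apply Rdiv_lt_0_compat; [apply Rmult_lt_0_compat|]; lra).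
  destruct (Hl e He') as [delta [Hd Hdelta]].
  exists (delta / 2); split; [lra|].
  intros a b c d Ha Hb Hc Hd' Hsize.
  set (s := (b - a) + (d - c)) in *.
  set (L := fun w => (f zeta + (z - zeta) * l + l * (w - z))%C).
  assert (CL : ccont_in_disk L).
  { intros w _. unfold L.
    apply ccont_plus; [apply ccont_const|]. apply ccont_mult; [apply ccont_const|].
    apply ccont_plus; [apply ccont_id | apply ccont_const]. }
  pose proof (holo_ccont f Hf) as Cf.
  replace (boundary_integral r z f a b c d)
    with (boundary_integral r z (fun w => f w - L w)%C a b c d).
  2:{ rewrite boundary_integral_minus by (auto; lra).
      unfold L. rewrite boundary_integral_affine by (auto; lra). ring. }
  replace (eps * s ^ 2) with (2 * (e * (2 * s)) / (r - Cmod z) * s)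
    by (unfold e; field; lra).
  apply boundary_integral_bound; auto; try lra.
  - intros w Hw. apply ccont_plus; [apply Cf; auto|].
    apply (ccont_comp L Copp); [apply CL; auto|].
    intros q Hq. exists q; split; auto. intros v Hv.
    replace (- v - - L w)%C with (- (v - L w))%C by ring.
    rewrite Cmod_opp; auto.
  - intros u t Hu Ht.
    assert (Hdist : Cmod (spoke r z u t - zeta)%C <= 2 * s).
    { eapply Rle_trans; [apply spoke_lipschitz; auto; lra|].
      assert (Rabs (u - x) <= b - a) by (apply Rabs_le; lra).
      assert (Rabs (t - y) <= d - c) by (apply Rabs_le; lra).
      unfold s; lra. }
    replace (f (spoke r z u t) - L (spoke r z u t))%C
      with (f (spoke r z u t) - f zeta - (spoke r z u t - zeta) * l)%C
      by (unfold L; ring).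
    eapply Rle_trans; [apply Hdelta; lra|].
    apply Rmult_le_compat_l; lra.
Qed.

Lemma boundary_integral_zero (r : R) (z : C) (f : C -> C) (a c d : R) :
  0 < r < 1 -> Cmod z < r -> holo f -> a <= 0 -> c <= d ->
  boundary_integral r z f a 0 c d = 0.
Proof.
  intros Hr Hz Hf Ha Hcd. pose proof (holo_ccont f Hf) as Cf.
  apply additive_rectangle_function_zero; auto.
  - intros a1 m b c1 d1 H1 H2 H3 H4.
    assert (E : forall y, CInt (fun s => f (spoke r z s y)) a1 b
      = (CInt (fun s => f (spoke r z s y)) a1 m + CInt (fun s => f (spoke r z s y)) m b)%C).
    { intros y. apply is_CInt_unique. eapply is_CInt_Chasles; apply is_CInt_CInt;
        try lra; intros; apply pcont_radial; auto; lra. }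
    unfold boundary_integral. rewrite !E. ring.
  - intros a1 b c1 k d1 H1 H2 H3 H4.
    assert (E : forall x, x <= 0 ->
      CInt (fun t => Ci * (f (spoke r z x t) * cauchy_kernel r z t))%C c1 d1
      = (CInt (fun t => Ci * (f (spoke r z x t) * cauchy_kernel r z t))%C c1 k
         + CInt (fun t => Ci * (f (spoke r z x t) * cauchy_kernel r z t))%C k d1)%C).
    { intros x Hx. apply is_CInt_unique. eapply is_CInt_Chasles; apply is_CInt_CInt;
        try lra; intros; apply pcont_circular; auto; lra. }
    unfold boundary_integral. rewrite !E by lra. ring.
  - intros x y eps Hx Hy He.
    destruct (boundary_integral_local r z f x y eps) as [delta [Hd H]]; auto; try lra.
    exists delta; split; auto. intros; apply H; lra.
Qed.

(** The coordinate rectangle [[s, 0] x [0, 2 PI]] has the same image on its two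
    radial sides, so its two circular sides carry equal integrals. *)
Lemma circle_mean_shrink (r : R) (z : C) (f : C -> C) (s : R) :
  0 < r < 1 -> Cmod z < r -> holo f -> s <= 0 ->
  CInt (fun t => f (spoke r z 0 t) * cauchy_kernel r z t)%C 0 (2 * PI)
  = CInt (fun t => f (spoke r z s t) * cauchy_kernel r z t)%C 0 (2 * PI).
Proof.
  intros Hr Hz Hf Hs. pose proof (holo_ccont f Hf) as Cf.
  pose proof PI_RGT_0 as Ppi.
  pose proof (boundary_integral_zero r z f s 0 (2 * PI) Hr Hz Hf Hs ltac:(lra)) as H.
  unfold boundary_integral in H.
  replace (CInt (fun u => f (spoke r z u (2 * PI))) s 0)
    with (CInt (fun u => f (spoke r z u 0)) s 0) in H
    by (unfold spoke, ray; rewrite cis_0, cis_2PI; reflexivity).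
  assert (E : forall x, x <= 0 ->
    CInt (fun t => Ci * (f (spoke r z x t) * cauchy_kernel r z t))%C 0 (2 * PI)
    = (Ci * CInt (fun t => f (spoke r z x t) * cauchy_kernel r z t) 0 (2 * PI))%C).
  { intros x Hx. apply is_CInt_unique, is_CInt_scal, is_CInt_CInt; [lra|].
    intros t _. apply pcont_mult; [|apply pcont_kernel; lra].
    apply (pcont_comp f (spoke r z x)); [apply pcont_spoke_t|].
    apply Cf, spoke_in_disk; auto. }
  rewrite !E in H by lra.
  set (P := CInt (fun t => f (spoke r z 0 t) * cauchy_kernel r z t)%C 0 (2 * PI)) in *.
  set (Q := CInt (fun t => f (spoke r z s t) * cauchy_kernel r z t)%C 0 (2 * PI)) in *.
  set (A := CInt (fun u => f (spoke r z u 0)) s 0) in *.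
  replace P with ((A + Ci * P - A - Ci * Q) / Ci + Q)%C.
  - rewrite H. field. intro E0. assert (Cmod Ci = 0) by (rewrite E0; apply Cmod_0).
    rewrite Cmod_Ci in *; lra.
  - field. intro E0. assert (Cmod Ci = 0) by (rewrite E0; apply Cmod_0).
    rewrite Cmod_Ci in *; lra.
Qed.

(** The circle can be shrunk onto [z], where continuity of [f] identifies the
    limit. *)
Lemma cauchy_formula_kernel (r : R) (z : C) (f : C -> C) :
  0 < r < 1 -> Cmod z < r -> holo f ->
  CInt (fun t => f (RtoC r * cis t) * cauchy_kernel r z t)%C 0 (2 * PI)
  = (f z * CInt (cauchy_kernel r z) 0 (2 * PI))%C.
Proof.
  intros Hr Hz Hf. pose proof (holo_ccont f Hf) as Cf.
  pose proof PI_RGT_0 as Ppi. pose proof (Cmod_ge_0 z) as Pz.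
  replace (CInt (fun t => f (r * cis t) * cauchy_kernel r z t)%C 0 (2 * PI))
    with (CInt (fun t => f (spoke r z 0 t) * cauchy_kernel r z t)%C 0 (2 * PI)).
  2:{ apply is_CInt_unique.
      assert (E : forall t, spoke r z 0 t = (RtoC r * cis t)%C)
        by (intros t; unfold spoke, ray; rewrite exp_0; ring).
      apply (is_CInt_ext (fun t => f (RtoC r * cis t) * cauchy_kernel r z t)%C); [lra| |].
      - intros t _. rewrite E. reflexivity.
      - apply is_CInt_CInt; [lra|]. intros t _.
        apply pcont_mult; [|apply pcont_kernel; lra].
        apply (pcont_comp f (fun t => RtoC r * cis t)%C).
        + apply pcont_mult; [apply pcont_const | apply pcont_cis].
        + rewrite <- E. apply Cf, spoke_in_disk; auto; lra. }
  set (P := CInt (fun t => f (spoke r z 0 t) * cauchy_kernel r z t)%C 0 (2 * PI)).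
  set (Q := (f z * CInt (cauchy_kernel r z) 0 (2 * PI))%C).
  assert (Hsmall : forall eps, 0 < eps ->
    Cmod (P - Q)%C <= 2 * PI * (eps * (r / (r - Cmod z)))).
  { intros eps He.
    destruct (Cf z ltac:(lra) eps He) as [delta [Hd Hdelta]].
    set (s := Rmin 0 (ln (delta / 3))).
    assert (Hs : s <= 0) by apply Rmin_l.
    assert (Hes : exp s <= delta / 3).
    { rewrite <- (exp_ln (delta / 3)) by lra. apply exp_le, Rmin_r. }
    unfold P. rewrite (circle_mean_shrink r z f s) by auto.
    replace (2 * PI) with (2 * PI - 0) at 2 by ring.
    apply (is_CInt_Cmod_le_const (fun t => f (spoke r z s t) * cauchy_kernel r z t
             - f z * cauchy_kernel r z t)%C); [lra| |].
    - apply is_CInt_minus; [apply is_CInt_CInt | apply is_CInt_scal, is_CInt_CInt];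
        try lra; intros t _; [|apply pcont_kernel; lra].
      apply pcont_mult; [|apply pcont_kernel; lra].
      apply (pcont_comp f (spoke r z s)); [apply pcont_spoke_t|].
      apply Cf, spoke_in_disk; auto.
    - intros t _.
      replace (f (spoke r z s t) * cauchy_kernel r z t - f z * cauchy_kernel r z t)%C
        with ((f (spoke r z s t) - f z) * cauchy_kernel r z t)%C by ring.
      rewrite Cmod_mult. apply Rmult_le_compat; try apply Cmod_ge_0.
      + left; apply Hdelta. unfold spoke.
        replace (z + exp s * ray r z t - z)%C with (RtoC (exp s) * ray r z t)%C by ring.
        pose proof (exp_pos s).
        rewrite Cmod_mult, Cmod_R, Rabs_right by lra.
        pose proof (Cmod_ray_le r z t ltac:(lra)). pose proof (Cmod_ge_0 (ray r z t)).
        nra.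
      + apply Cmod_kernel_le; lra. }
  destruct (Ceq_dec (P - Q)%C 0) as [E|N].
  - replace P with (P - Q + Q)%C by ring. rewrite E. ring.
  - exfalso. assert (0 < Cmod (P - Q)%C) by (apply Cmod_gt_0; auto).
    set (K := 2 * PI * (r / (r - Cmod z))).
    assert (HK : 0 < K).
    { apply Rmult_lt_0_compat; [lra|]. apply Rdiv_lt_0_compat; lra. }
    specialize (Hsmall (Cmod (P - Q)%C / (2 * K))
                  ltac:(apply Rdiv_lt_0_compat; lra)).
    replace (2 * PI * (Cmod (P - Q)%C / (2 * K) * (r / (r - Cmod z))))
      with (Cmod (P - Q)%C / (2 * K) * K) in Hsmall by (unfold K; ring).
    replace (Cmod (P - Q)%C / (2 * K) * K) with (Cmod (P - Q)%C / 2) in Hsmall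
      by (field; lra).
    lra.
Qed.

(** * Cauchy integrals and their derivatives *)

(** A remainder that is quadratic uniformly in the parameter stays quadratic
    after integration. *)
Lemma cdiff_CInt (phi : R -> C) (k : C -> R -> C) (k' : R -> C) (z : C)
    (a b eta K : R) :
  a <= b -> 0 < eta ->
  (forall t, a <= t <= b -> pcont phi t) ->
  (forall w t, Cmod (w - z)%C < eta -> a <= t <= b -> pcont (k w) t) ->
  (forall t, a <= t <= b -> pcont k' t) ->
  (forall w t, Cmod (w - z)%C < eta -> a <= t <= b ->
     Cmod (k w t - k z t - (w - z) * k' t)%C <= K * Cmod (w - z)%C ^ 2) ->
  cdiff (fun w => CInt (fun t => phi t * k w t)%C a b) z
        (CInt (fun t => phi t * k' t)%C a b).
Proof.
  intros Hab Heta Hphi Hk Hk' HK.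
  set (N := fun t => Cmod (phi t)).
  assert (HN : is_RInt N a b (RInt N a b)).
  { apply (RInt_correct (V := R_CompleteNormedModule)).
    apply (ex_RInt_continuous (V := R_CompleteNormedModule)).
    rewrite Rmin_left, Rmax_right by auto. intros t Ht.
    apply continuous_eps. intros eps He.
    destruct (proj1 (pcont_eps phi t) (Hphi t Ht) eps He) as [d [Hd D]].
    exists d; split; auto. intros s Hs. specialize (D s Hs).
    pose proof (Cmod_ge_sub (phi s) (phi t)).
    pose proof (Cmod_ge_sub (phi t) (phi s)) as H2. rewrite Cmod_sub_sym in H2.
    unfold N. apply Rabs_def1; lra. }
  apply (cdiff_quadratic _ _ _ eta (K * RInt N a b)); auto.
  intros w Hw.
  assert (Hz : Cmod (z - z)%C < eta)
    by (replace (z - z)%C with (RtoC 0) by ring; rewrite Cmod_0; auto).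
  apply (is_CInt_Cmod_le
    (fun t => phi t * k w t - phi t * k z t - (w - z) * (phi t * k' t))%C
    (fun t => K * Cmod (w - z)%C ^ 2 * N t) a b); auto.
  - apply is_CInt_minus; [apply is_CInt_minus | apply is_CInt_scal];
      apply is_CInt_CInt; auto; intros; apply pcont_mult; auto.
  - replace (K * RInt N a b * Cmod (w - z)%C ^ 2)
      with (scal (K * Cmod (w - z)%C ^ 2) (RInt N a b))
      by (unfold scal; simpl; unfold mult; simpl; ring).
    apply (is_RInt_scal (V := R_NormedModule)); auto.
  - intros t Ht.
    replace (phi t * k w t - phi t * k z t - (w - z) * (phi t * k' t))%C
      with ((k w t - k z t - (w - z) * k' t) * phi t)%C by ring.
    rewrite Cmod_mult. apply Rmult_le_compat_r; [apply Cmod_ge_0 | apply HK; auto].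
Qed.

Lemma ray_near (r : R) (z w : C) (t : R) :
  0 < r -> Cmod z < r -> Cmod (w - z)%C < (r - Cmod z) / 2 ->
  (r - Cmod z) / 2 <= Cmod (ray r w t) /\ ray r w t <> 0.
Proof.
  intros Hr Hz Hw.
  assert (H : (r - Cmod z) / 2 <= Cmod (ray r w t)).
  { pose proof (Cmod_ray_ge r w t Hr).
    pose proof (Cmod_ge_sub w z). lra. }
  split; auto. apply Cmod_gt_0; lra.
Qed.

Lemma Cmod_inv_le (x : C) (rho : R) :
  0 < rho -> rho <= Cmod x -> Cmod (/ x)%C <= / rho.
Proof.
  intros Hr H. rewrite Cmod_inv by (apply Cmod_gt_0; lra).
  apply Rinv_le_contravar; auto.
Qed.

Lemma pcont_inv_ray (r : R) (z : C) (t : R) :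
  ray r z t <> 0 -> pcont (fun t => / ray r z t)%C t.
Proof.
  intros H. apply (pcont_comp Cinv (ray r z)); [apply pcont_ray|].
  eapply cdiff_ccont, cdiff_inv; auto.
Qed.

Lemma cdiff_cauchy_integral (phi : R -> C) (r : R) (z : C) :
  0 < r -> Cmod z < r -> (forall t, pcont phi t) ->
  cdiff (fun w => CInt (fun t => phi t * / ray r w t)%C 0 (2 * PI)) z
        (CInt (fun t => phi t * (/ ray r z t * / ray r z t))%C 0 (2 * PI)).
Proof.
  intros Hr Hz Hphi. pose proof PI_RGT_0 as Ppi.
  set (rho := (r - Cmod z) / 2). assert (Hrho : 0 < rho) by (unfold rho; lra).
  assert (Hzz : Cmod (z - z)%C < rho)
    by (replace (z - z)%C with (RtoC 0) by ring; rewrite Cmod_0; auto).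
  apply (cdiff_CInt phi (fun w t => / ray r w t)%C
           (fun t => / ray r z t * / ray r z t)%C z 0 (2 * PI) rho (/ rho * (/ rho * / rho)));
    auto; try lra.
  - intros w t Hw _. apply pcont_inv_ray. apply (ray_near r z); auto.
  - intros t _. apply pcont_mult; apply pcont_inv_ray, ray_neq_0; auto.
  - intros w t Hw _.
    destruct (ray_near r z w t Hr Hz Hw) as [B1 N1].
    destruct (ray_near r z z t Hr Hz Hzz) as [B2 N2].
    replace (/ ray r w t - / ray r z t - (w - z) * (/ ray r z t * / ray r z t))%C
      with (/ ray r w t * (/ ray r z t * / ray r z t) * ((w - z) * (w - z)))%C
      by (unfold ray in *; field; split; auto).
    rewrite !Cmod_mult.
    replace (Cmod (w - z)%C ^ 2) with (Cmod (w - z)%C * Cmod (w - z)%C) by ring.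
    apply Rmult_le_compat_r; [apply Rmult_le_pos; apply Cmod_ge_0|].
    repeat apply Rmult_le_compat; try apply Cmod_inv_le; auto;
      repeat apply Rmult_le_pos; apply Cmod_ge_0.
Qed.

Lemma cdiff_cauchy_integral_2 (phi : R -> C) (r : R) (z : C) :
  0 < r -> Cmod z < r -> (forall t, pcont phi t) ->
  exists l,
  cdiff (fun w => CInt (fun t => phi t * (/ ray r w t * / ray r w t))%C 0 (2 * PI)) z l.
Proof.
  intros Hr Hz Hphi. pose proof PI_RGT_0 as Ppi.
  set (rho := (r - Cmod z) / 2). assert (Hrho : 0 < rho) by (unfold rho; lra).
  assert (Hzz : Cmod (z - z)%C < rho)
    by (replace (z - z)%C with (RtoC 0) by ring; rewrite Cmod_0; auto).
  eexists.
  apply (cdiff_CInt phi (fun w t => / ray r w t * / ray r w t)%C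
           (fun t => 2 * (/ ray r z t * (/ ray r z t * / ray r z t)))%C z 0 (2 * PI) rho
           (3 * (/ rho * / rho * (/ rho * / rho))));
    auto; try lra.
  - intros w t Hw _. apply pcont_mult; apply pcont_inv_ray; apply (ray_near r z); auto.
  - intros t _. apply pcont_mult; [apply pcont_const|].
    apply pcont_mult; [|apply pcont_mult]; apply pcont_inv_ray, ray_neq_0; auto.
  - intros w t Hw _.
    destruct (ray_near r z w t Hr Hz Hw) as [B1 N1].
    destruct (ray_near r z z t Hr Hz Hzz) as [B2 N2].
    set (u := (/ ray r w t)%C). set (v := (/ ray r z t)%C).
    replace (u * u - v * v - (w - z) * (2 * (v * (v * v))))%C
      with ((2 * (u * v * (v * v)) + u * u * (v * v)) * ((w - z) * (w - z)))%C
      by (unfold u, v, ray in *; field; split; auto).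
    assert (Bu : Cmod u <= / rho) by (apply Cmod_inv_le; auto).
    assert (Bv : Cmod v <= / rho) by (apply Cmod_inv_le; auto).
    pose proof (Cmod_ge_0 u). pose proof (Cmod_ge_0 v).
    rewrite Cmod_mult.
    replace (Cmod (w - z)%C ^ 2) with (Cmod ((w - z) * (w - z))%C)
      by (rewrite Cmod_mult; ring).
    apply Rmult_le_compat_r; [apply Cmod_ge_0|].
    eapply Rle_trans; [apply Cmod_triangle|].
    rewrite !Cmod_mult, Cmod_R, Rabs_right by lra.
    set (q := / rho) in *.
    assert (A1 : Cmod u * Cmod v <= q * q) by (apply Rmult_le_compat; auto).
    assert (A2 : Cmod v * Cmod v <= q * q) by (apply Rmult_le_compat; auto).
    assert (A3 : Cmod u * Cmod u <= q * q) by (apply Rmult_le_compat; auto).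
    assert (Cmod u * Cmod v * (Cmod v * Cmod v) <= q * q * (q * q))
      by (apply Rmult_le_compat; auto; apply Rmult_le_pos; auto).
    assert (Cmod u * Cmod u * (Cmod v * Cmod v) <= q * q * (q * q))
      by (apply Rmult_le_compat; auto; apply Rmult_le_pos; auto).
    lra.
Qed.

Lemma pderiv_zero_const (g : R -> C) (a b : R) :
  a <= b -> (forall t, a <= t <= b -> pderiv g t 0) -> g b = g a.
Proof.
  intros Hab H.
  pose proof (is_CInt_pderiv g (fun _ => RtoC 0) a b Hab H
                (fun t _ => pcont_const 0 t)) as H1.
  pose proof (is_CInt_const 0 a b) as H2.
  apply is_CInt_unique in H1. apply is_CInt_unique in H2.
  replace (g b) with (g b - g a + g a)%C by ring.
  rewrite <- H1, H2. ring.
Qed.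

(** The derivative of this integral in [z] integrates the exact form
    [w dt / (w - z)^2] around the circle and so vanishes; the constant value is
    read off at [z = 0]. *)
Lemma CInt_cauchy_kernel (r : R) (z : C) :
  0 < r -> Cmod z < r ->
  CInt (cauchy_kernel r z) 0 (2 * PI) = RtoC (2 * PI).
Proof.
  intros Hr Hz. pose proof PI_RGT_0 as Ppi.
  set (K := fun w => CInt (fun t => RtoC r * cis t * / ray r w t)%C 0 (2 * PI)).
  assert (Hphi : forall t, pcont (fun t => RtoC r * cis t)%C t).
  { intros t. apply pcont_mult; [apply pcont_const | apply pcont_cis]. }
  assert (HK : forall w, Cmod w < r -> cdiff K w 0).
  { intros w Hw.
    replace (RtoC 0) with
      (CInt (fun t => RtoC r * cis t * (/ ray r w t * / ray r w t))%C 0 (2 * PI)).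
    { apply (cdiff_cauchy_integral (fun t => RtoC r * cis t)%C r w); auto. }
    replace (RtoC 0) with
      (Ci * / ray r w (2 * PI) - Ci * / ray r w 0)%C
      by (unfold ray; rewrite cis_0, cis_2PI; ring).
    apply is_CInt_unique.
    apply (is_CInt_pderiv (fun t => Ci * / ray r w t)%C); [lra| |].
    - intros t _.
      assert (N : ray r w t <> 0) by (apply ray_neq_0; auto).
      replace (RtoC r * cis t * (/ ray r w t * / ray r w t))%C
        with (RtoC r * (Ci * cis t) * - / (ray r w t * ray r w t) * Ci)%C.
      + apply (pderiv_scal Ci (fun t => / ray r w t)%C).
        apply (pderiv_comp Cinv (ray r w)); [apply pderiv_ray | apply cdiff_inv; auto].
      + replace (RtoC r * (Ci * cis t) * - / (ray r w t * ray r w t) * Ci)%C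
          with (- (Ci * Ci) * (RtoC r * cis t * (/ ray r w t * / ray r w t)))%C
          by (field; auto).
        replace (- (Ci * Ci))%C with (RtoC 1)
          by (apply C_ext; unfold Re, Im, Ci; simpl; ring).
        ring.
    - intros t _. apply pcont_mult; [apply Hphi|].
      apply pcont_mult; apply pcont_inv_ray, ray_neq_0; auto. }
  change (CInt (cauchy_kernel r z) 0 (2 * PI)) with (K z).
  assert (E : K (RtoC 0 + RtoC 1 * z)%C = K (RtoC 0 + RtoC 0 * z)%C).
  { apply (pderiv_zero_const (fun s => K (RtoC 0 + RtoC s * z)%C) 0 1); [lra|].
    intros s Hs.
    assert (D : pderiv (fun s => K (RtoC 0 + RtoC s * z)%C) s (z * RtoC 0)%C).
    2:{ rewrite Cmult_0_r in D. exact D. }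
    apply (pderiv_comp K (fun s => RtoC 0 + RtoC s * z)%C);
      [apply pderiv_affine | apply HK].
    rewrite Cplus_0_l, Cmod_mult, Cmod_R, Rabs_right by lra.
    pose proof (Cmod_ge_0 z). nra. }
  replace (RtoC 0 + RtoC 1 * z)%C with z in E by ring. rewrite E.
  unfold K. apply is_CInt_unique.
  apply (is_CInt_ext (fun _ => RtoC 1)); [lra| |].
  - intros t _. pose proof (cis_neq_0 t).
    unfold ray. field. split; auto. intro E0; apply RtoC_inj in E0; lra.
  - replace (RtoC (2 * PI)) with (RtoC (2 * PI - 0) * RtoC 1)%C
      by (rewrite Rminus_0_r; ring).
    apply is_CInt_const.
Qed.

Lemma RtoC_2PI_neq_0 : RtoC (2 * PI) <> 0.
Proof. pose proof PI_RGT_0. intro E; apply RtoC_inj in E; lra. Qed.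

Lemma pcont_on_circle (f : C -> C) (r t : R) :
  0 < r < 1 -> holo f -> pcont (fun t => f (RtoC r * cis t)%C) t.
Proof.
  intros Hr Hf. apply (pcont_comp f (fun t => RtoC r * cis t)%C).
  - apply pcont_mult; [apply pcont_const | apply pcont_cis].
  - apply holo_ccont; auto. rewrite Cmod_mult, Cmod_R, Cmod_cis, Rabs_right; lra.
Qed.

Lemma pcont_cauchy_density (f : C -> C) (r t : R) :
  0 < r < 1 -> holo f ->
  pcont (fun t => f (RtoC r * cis t) * (RtoC r * cis t))%C t.
Proof.
  intros Hr Hf. apply pcont_mult; [apply pcont_on_circle; auto|].
  apply pcont_mult; [apply pcont_const | apply pcont_cis].
Qed.

Theorem cauchy_formula (f : C -> C) (r : R) (z : C) :
  0 < r < 1 -> Cmod z < r -> holo f ->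
  f z = (/ RtoC (2 * PI) *
    CInt (fun t => f (RtoC r * cis t) * (RtoC r * cis t) * / ray r z t) 0 (2 * PI))%C.
Proof.
  intros Hr Hz Hf. pose proof PI_RGT_0 as Ppi.
  replace (CInt (fun t => f (RtoC r * cis t) * (RtoC r * cis t) * / ray r z t)%C 0 (2 * PI))
    with (f z * RtoC (2 * PI))%C.
  - field. apply RtoC_2PI_neq_0.
  - rewrite <- (CInt_cauchy_kernel r z), <- cauchy_formula_kernel by (auto; lra).
    apply is_CInt_unique.
    apply (is_CInt_ext (fun t => f (RtoC r * cis t) * (RtoC r * cis t) * / ray r z t)%C);
      [lra | intros; unfold cauchy_kernel, Cdiv; ring |].
    apply is_CInt_CInt; [lra|]. intros t _.
    apply pcont_mult; [apply pcont_cauchy_density; auto|].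
    apply pcont_inv_ray, ray_neq_0; lra.
Qed.

Lemma cdiff_scal (c : C) (f : C -> C) (z l : C) :
  cdiff f z l -> cdiff (fun w => c * f w)%C z (c * l)%C.
Proof.
  intros H. replace (c * l)%C with (0 * f z + c * l)%C by ring.
  apply (cdiff_mult (fun _ => c) f); auto. apply cdiff_const.
Qed.

Lemma cauchy_formula_derivative (f : C -> C) (r : R) (z : C) :
  0 < r < 1 -> Cmod z < r -> holo f ->
  cdiff f z (/ RtoC (2 * PI) *
    CInt (fun t => f (RtoC r * cis t) * (RtoC r * cis t)
                   * (/ ray r z t * / ray r z t)) 0 (2 * PI))%C.
Proof.
  intros Hr Hz Hf.
  apply (cdiff_ext_ball (fun w => / RtoC (2 * PI) *
    CInt (fun t => f (RtoC r * cis t) * (RtoC r * cis t) * / ray r w t) 0 (2 * PI))%C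
    _ _ _ (r - Cmod z)); [lra| |].
  - intros w Hw. symmetry. apply cauchy_formula; auto.
    pose proof (Cmod_ge_sub w z). lra.
  - apply cdiff_scal.
    apply (cdiff_cauchy_integral (fun t => f (RtoC r * cis t) * (RtoC r * cis t))%C); try lra.
    intros t. apply pcont_cauchy_density; auto.
Qed.

Lemma cdiff_C_derive_eq (f : C -> C) (z l : C) : cdiff f z l -> C_derive f z = l.
Proof. intros H. apply is_C_derive_unique, is_derive_of_cdiff; auto. Qed.

Lemma cdiff_C_derive (f : C -> C) (z : C) :
  holo f -> Cmod z < 1 -> cdiff f z (C_derive f z).
Proof.
  intros Hf Hz. destruct (Hf z Hz) as [l Hl].
  rewrite (cdiff_C_derive_eq f z l Hl). exact Hl.
Qed.

(** Near each point the derivative is itself a Cauchy integral, with a squared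
    kernel that can be differentiated once more. *)
Theorem holo_C_derive (f : C -> C) : holo f -> holo (C_derive f).
Proof.
  intros Hf z Hz. pose proof (Cmod_ge_0 z) as Pz.
  set (r := (1 + Cmod z) / 2).
  assert (Hr : 0 < r < 1) by (unfold r; lra).
  assert (Hzr : Cmod z < r) by (unfold r; lra).
  destruct (cdiff_cauchy_integral_2 (fun t => f (RtoC r * cis t) * (RtoC r * cis t))%C r z)
    as [l Hl]; try lra.
  { intros t. apply pcont_cauchy_density; auto. }
  exists (/ RtoC (2 * PI) * l)%C.
  apply (cdiff_ext_ball (fun w => / RtoC (2 * PI) *
    CInt (fun t => f (RtoC r * cis t) * (RtoC r * cis t)
                   * (/ ray r w t * / ray r w t)) 0 (2 * PI))%C _ _ _ (r - Cmod z)).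
  - lra.
  - intros w Hw. symmetry. apply cdiff_C_derive_eq.
    apply cauchy_formula_derivative; auto. pose proof (Cmod_ge_sub w z). lra.
  - apply cdiff_scal. exact Hl.
Qed.

(** * Schwarz-Pick type bounds *)

(** On the circle of radius [r], the Fourier coefficient of [p] against
    [Cconj (cis t)] is [r * l] and that of [Cconj p] vanishes. Their sum is the
    coefficient of [2 * Re p], which is at most the mean of this nonnegative
    function. *)
Lemma caratheodory_circle (p : C -> C) (l : C) (r : R) :
  0 < r < 1 -> holo p -> (forall w, Cmod w < 1 -> 0 <= Re (p w)) ->
  cdiff p 0 l -> r * Cmod l <= 2 * Re (p 0).
Proof.
  intros Hr Hp Hpos Hl. pose proof PI_RGT_0 as Ppi.
  assert (H0 : Cmod 0 < r) by (rewrite Cmod_0; lra).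
  assert (Hray : forall t, ray r 0 t = (RtoC r * cis t)%C)
    by (intros; unfold ray; ring).
  assert (Nr : RtoC r <> 0) by (intro E; apply RtoC_inj in E; lra).
  set (P := fun t => p (RtoC r * cis t)%C).
  assert (CP : forall t, pcont P t) by (intros; apply pcont_on_circle; auto).
  assert (Ccis : forall t, pcont (fun t => Cconj (cis t)) t)
    by (intros; apply pcont_conj, pcont_cis).
  assert (Mean : is_CInt P 0 (2 * PI) (RtoC (2 * PI) * p 0)%C).
  { rewrite (cauchy_formula p r 0) by auto.
    rewrite Cmult_assoc, Cinv_r, Cmult_1_l by apply RtoC_2PI_neq_0.
    replace (CInt _ 0 (2 * PI)) with (CInt P 0 (2 * PI)).
    - apply is_CInt_CInt; [lra|]; auto.
    - apply is_CInt_unique.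
      apply (is_CInt_ext (fun t => p (RtoC r * cis t) * (RtoC r * cis t) * / ray r 0 t)%C);
        [lra| |].
      + intros t _. rewrite Hray. unfold P. field.
        split; [apply cis_neq_0 | auto].
      + apply is_CInt_CInt; [lra|]. intros t _.
        apply pcont_mult; [apply pcont_cauchy_density; auto|].
        apply pcont_inv_ray, ray_neq_0; lra. }
  assert (Deriv : is_CInt (fun t => P t * Cconj (cis t))%C 0 (2 * PI)
                    (RtoC (2 * PI) * (RtoC r * l))%C).
  { pose proof (cdiff_C_derive_eq _ _ _ Hl) as E1.
    pose proof (cdiff_C_derive_eq _ _ _ (cauchy_formula_derivative p r 0 Hr H0 Hp)) as E2.
    rewrite E1 in E2. rewrite E2.
    replace (CInt _ 0 (2 * PI))
      with (/ RtoC r * CInt (fun t => P t * Cconj (cis t)) 0 (2 * PI))%C.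
    - match goal with |- is_CInt _ _ _ ?x =>
        replace x with (CInt (fun t => P t * Cconj (cis t))%C 0 (2 * PI)) end.
      + apply is_CInt_CInt; [lra|]. intros; apply pcont_mult; auto.
      + field. split; [exact Nr | apply RtoC_2PI_neq_0].
    - symmetry. apply is_CInt_unique.
      apply (is_CInt_ext (fun t => / RtoC r * (P t * Cconj (cis t)))%C); [lra| |].
      + intros t _. rewrite Hray, Cconj_cis. unfold P. field.
        split; [apply cis_neq_0 | auto].
      + apply is_CInt_scal, is_CInt_CInt; [lra|]. intros; apply pcont_mult; auto. }
  (* The mean value property of [w * p w], conjugated. *)
  assert (Conj : is_CInt (fun t => Cconj (P t) * Cconj (cis t))%C 0 (2 * PI) 0).
  { assert (Hq : holo (fun w => w * p w)%C).
    { intros w Hw. destruct (Hp w Hw) as [m Hm]. eexists.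
      apply (cdiff_mult (fun w => w) p); [apply cdiff_id | exact Hm]. }
    pose proof (cauchy_formula (fun w => w * p w)%C r 0 Hr H0 Hq) as E.
    cbv beta in E. rewrite Cmult_0_l in E.
    set (I := CInt _ 0 (2 * PI)) in E.
    assert (EI : I = 0).
    { replace I with (RtoC (2 * PI) * (/ RtoC (2 * PI) * I))%C
        by (field; apply RtoC_2PI_neq_0).
      rewrite <- E. ring. }
    replace (RtoC 0) with (Cconj (/ RtoC r * I))%C
      by (rewrite EI; apply C_ext; unfold Re, Im; simpl; ring).
    apply (is_CInt_ext (fun t => Cconj (/ RtoC r *
      (RtoC r * cis t * p (RtoC r * cis t) * (RtoC r * cis t) * / ray r 0 t)))%C); [lra| |].
    - intros t _. rewrite <- Cmult_conj. f_equal. rewrite Hray. unfold P. field.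
      split; [apply cis_neq_0 | auto].
    - apply is_CInt_conj, is_CInt_scal, is_CInt_CInt; [lra|]. intros t _.
      apply pcont_mult; [|apply pcont_inv_ray, ray_neq_0; lra].
      apply (pcont_cauchy_density (fun w => w * p w)%C); auto. }
  pose proof (is_CInt_plus _ _ _ _ _ _ Deriv Conj) as Sum.
  assert (B : Cmod (RtoC (2 * PI) * (RtoC r * l) + 0)%C
              <= 2 * Re (RtoC (2 * PI) * p 0)%C).
  { eapply (is_CInt_Cmod_le _ (fun t => 2 * Re (P t))); [|exact Sum| |]; [lra| |].
    - destruct Mean as [Mean _].
      apply (is_RInt_scal (V := R_NormedModule) _ _ _ 2 _ Mean).
    - intros t _. cbv beta.
      replace (P t * Cconj (cis t) + Cconj (P t) * Cconj (cis t))%C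
        with (RtoC (2 * Re (P t)) * Cconj (cis t))%C.
      + rewrite Cmod_mult, Cmod_conj, Cmod_cis, Cmod_R, Rabs_right; [lra|].
        assert (0 <= Re (P t)); [|lra].
        apply Hpos. rewrite Cmod_mult, Cmod_R, Cmod_cis, Rabs_right; lra.
      + rewrite <- Cmult_plus_distr_r. f_equal.
        apply C_ext; unfold Re, Im; simpl; ring. }
  rewrite Cplus_0_r, !Cmod_mult, !Cmod_R, !Rabs_right in B by lra.
  rewrite re_scal_l in B.
  apply (Rmult_le_reg_l (2 * PI)); lra.
Qed.

Lemma caratheodory (p : C -> C) (l : C) :
  holo p -> (forall w, Cmod w < 1 -> 0 <= Re (p w)) ->
  cdiff p 0 l -> Cmod l <= 2 * Re (p 0).
Proof.
  intros Hp Hpos Hl. pose proof (Cmod_ge_0 l) as Pl.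
  assert (P0 : 0 <= Re (p 0)) by (apply Hpos; rewrite Cmod_0; lra).
  apply Rnot_lt_le; intro N.
  set (r := (2 * Re (p 0) / Cmod l + 1) / 2).
  assert (Hq : 0 <= 2 * Re (p 0) / Cmod l < 1).
  { split; [apply Rle_div_r; lra | apply Rlt_div_l; lra]. }
  pose proof (caratheodory_circle p l r ltac:(unfold r; lra) Hp Hpos Hl) as H.
  assert (E : 2 * Re (p 0) / Cmod l * Cmod l = 2 * Re (p 0)) by (field; lra).
  unfold r in H. nra.
Qed.

Lemma exists_phase (w : C) : exists c, Cmod c = 1 /\ (c * w)%C = RtoC (Cmod w).
Proof.
  destruct (Ceq_dec w 0) as [->|N].
  - exists (RtoC 1). rewrite Cmod_1, Cmod_0. split; [reflexivity | ring].
  - assert (P : 0 < Cmod w) by (apply Cmod_gt_0; auto).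
    assert (P' : RtoC (Cmod w) <> 0) by (intro E; apply RtoC_inj in E; lra).
    exists (Cconj w / RtoC (Cmod w))%C. split.
    + rewrite Cmod_div, Cmod_conj, Cmod_R, Rabs_right by (auto; lra). field; lra.
    + replace (Cconj w / Cmod w * w)%C with (w * Cconj w / RtoC (Cmod w))%C by (field; auto).
      rewrite <- Cmod2_conj. simpl. rewrite !RtoC_mult. field; auto.
Qed.

Definition disk_automorphism (a w : C) : C := ((w + a) / (1 + Cconj a * w))%C.

Lemma disk_automorphism_denominator (a w : C) :
  Cmod a < 1 -> Cmod w < 1 -> (1 + Cconj a * w)%C <> 0.
Proof.
  intros Ha Hw. apply Cmod_gt_0.
  pose proof (Cmod_ge_sub (RtoC 1) (- (Cconj a * w))%C) as H.
  rewrite Cmod_1, Cmod_opp, Cmod_mult, Cmod_conj in H.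
  replace (1 - - (Cconj a * w))%C with (1 + Cconj a * w)%C in H by ring.
  pose proof (Cmod_ge_0 a). pose proof (Cmod_ge_0 w). nra.
Qed.

Lemma disk_automorphism_in_disk (a w : C) :
  Cmod a < 1 -> Cmod w < 1 -> Cmod (disk_automorphism a w) < 1.
Proof.
  intros Ha Hw. pose proof (disk_automorphism_denominator a w Ha Hw) as N.
  unfold disk_automorphism. rewrite Cmod_div by auto.
  assert (P : 0 < Cmod (1 + Cconj a * w)%C) by (apply Cmod_gt_0; auto).
  apply Rlt_div_l; [exact P|]. rewrite Rmult_1_l.
  apply Rsqr_incrst_0; try apply Cmod_ge_0. rewrite !Rsqr_pow2.
  assert (E : Cmod (1 + Cconj a * w)%C ^ 2 - Cmod (w + a)%C ^ 2
              = (1 - Cmod a ^ 2) * (1 - Cmod w ^ 2)).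
  { rewrite !Cmod2_alt. destruct a, w; unfold Re, Im; simpl; ring. }
  assert (0 < 1 - Cmod a ^ 2) by (pose proof (Cmod_ge_0 a); nra).
  assert (0 < 1 - Cmod w ^ 2) by (pose proof (Cmod_ge_0 w); nra).
  assert (0 < (1 - Cmod a ^ 2) * (1 - Cmod w ^ 2)) by (apply Rmult_lt_0_compat; auto).
  lra.
Qed.

Lemma cdiff_disk_automorphism (a w : C) :
  (1 + Cconj a * w)%C <> 0 ->
  cdiff (disk_automorphism a) w
    ((1 - a * Cconj a) / ((1 + Cconj a * w) * (1 + Cconj a * w)))%C.
Proof.
  intros N.
  replace (1 - a * Cconj a)%C
    with ((1 + 0) * (1 + Cconj a * w) - (w + a) * (0 + Cconj a * 1))%C by ring.
  apply (cdiff_div (fun w => w + a)%C (fun w => 1 + Cconj a * w)%C); auto.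
  - apply cdiff_plus; [apply cdiff_id | apply cdiff_const].
  - apply (cdiff_plus (fun _ => RtoC 1) (fun w => Cconj a * w)%C);
      [apply cdiff_const | apply cdiff_scal, cdiff_id].
Qed.

(** Caratheodory's inequality is moved to the centre [a] by a disk automorphism
    and applied to [1 - c * omega], where [omega = G / H] and [c] is unimodular
    with [c * omega a >= 0]; this bounds [(1 - |a|^2) * |omega' a|] by
    [2 * (1 - |omega a|)]. The sharp Schwarz-Pick lemma has the constant [1] in
    place of [2]. *)
Lemma weak_schwarz_pick (G H : C -> C) (a G' H' : C) :
  holo G -> holo H -> (forall w, Cmod w < 1 -> Cmod (G w) < Cmod (H w)) ->
  Cmod a < 1 -> cdiff G a G' -> cdiff H a H' ->
  (1 - Cmod a ^ 2) * Cmod (G' * H a - G a * H')%C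
  <= 2 * (Cmod (H a) ^ 2 - Cmod (G a) ^ 2).
Proof.
  intros HG HH Hlt Ha HG' HH'.
  assert (NH : forall w, Cmod w < 1 -> H w <> 0).
  { intros w Hw. apply Cmod_gt_0. pose proof (Hlt w Hw). pose proof (Cmod_ge_0 (G w)). lra. }
  destruct (exists_phase (G a / H a)%C) as [c [Hc1 Hc2]].
  set (T := disk_automorphism a).
  assert (T0 : T 0 = a) by (unfold T, disk_automorphism; field; intro E; apply RtoC_inj in E; lra).
  set (p := fun w => (1 + - c * (G (T w) / H (T w)))%C).
  assert (D : forall w A B, Cmod w < 1 -> cdiff G (T w) A -> cdiff H (T w) B ->
    cdiff p w (0 + - c * ((1 - a * Cconj a) / ((1 + Cconj a * w) * (1 + Cconj a * w))
                 * ((A * H (T w) - G (T w) * B) / (H (T w) * H (T w)))))%C).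
  { intros w A B Hw HA HB. unfold p.
    apply (cdiff_plus (fun _ => RtoC 1) (fun w => - c * (G (T w) / H (T w)))%C);
      [apply cdiff_const|].
    apply (cdiff_scal (- c)%C (fun w => G (T w) / H (T w))%C).
    apply (cdiff_comp T (fun w => G w / H w)%C).
    - apply cdiff_disk_automorphism, disk_automorphism_denominator; auto.
    - apply cdiff_div; auto. apply NH, disk_automorphism_in_disk; auto. }
  assert (Hp : holo p).
  { intros w Hw. pose proof (disk_automorphism_in_disk a w Ha Hw) as HT.
    destruct (HG _ HT) as [A HA]. destruct (HH _ HT) as [B HB].
    eexists. apply (D w A B); auto. }
  assert (Hpos : forall w, Cmod w < 1 -> 0 <= Re (p w)).
  { intros w Hw. pose proof (disk_automorphism_in_disk a w Ha Hw) as HT.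
    pose proof (re_le_Cmod (c * (G (T w) / H (T w)))%C) as B.
    assert (PH : 0 < Cmod (H (T w))) by (apply Cmod_gt_0, NH; auto).
    rewrite Cmod_mult, Hc1, Cmod_div, Rmult_1_l in B by (apply NH; auto).
    assert (Cmod (G (T w)) / Cmod (H (T w)) <= 1).
    { apply Rle_div_l; auto. rewrite Rmult_1_l. left; apply Hlt; auto. }
    pose proof (Rle_abs (Re (c * (G (T w) / H (T w)))%C)).
    replace (Re (p w)) with (1 - Re (c * (G (T w) / H (T w)))%C)
      by (unfold p, Re; simpl; ring).
    lra. }
  assert (H0 : Cmod 0 < 1) by (rewrite Cmod_0; lra).
  pose proof (caratheodory p _ Hp Hpos (D 0 G' H' H0 ltac:(rewrite T0; auto)
                                          ltac:(rewrite T0; auto))) as B.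
  assert (PH : 0 < Cmod (H a)) by (apply Cmod_gt_0, NH; auto).
  assert (Ep : Re (p 0) = 1 - Cmod (G a) / Cmod (H a)).
  { unfold p. rewrite T0.
    replace (1 + - c * (G a / H a))%C with (1 - c * (G a / H a))%C by ring.
    rewrite Hc2, Cmod_div by (apply NH; auto). unfold Re; simpl; ring. }
  rewrite T0, Ep in B.
  replace (0 + - c * ((1 - a * Cconj a) / ((1 + Cconj a * 0) * (1 + Cconj a * 0))
                      * ((G' * H a - G a * H') / (H a * H a))))%C
    with (- c * (RtoC (1 - Cmod a ^ 2) * ((G' * H a - G a * H') / (H a * H a))))%C in B.
  2:{ rewrite RtoC_minus, Cmod2_conj.
      field. apply NH; auto. }
  rewrite Cmod_mult, Cmod_opp, Hc1, Cmod_mult, Cmod_R, Cmod_div, Cmod_mult, Rabs_right in B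
    by (first [apply Cmult_neq_0; apply NH; auto | pose proof (Cmod_ge_0 a); nra]).
  set (W := Cmod (G' * H a - G a * H')%C) in *.
  set (x := Cmod (G a)) in *. set (y := Cmod (H a)) in *.
  assert (Hxy : x < y) by (apply Hlt; auto).
  assert (Px : 0 <= x) by apply Cmod_ge_0.
  assert (B' : (1 - Cmod a ^ 2) * W <= 2 * (1 - x / y) * (y * y)).
  { replace ((1 - Cmod a ^ 2) * W)
      with (1 * ((1 - Cmod a ^ 2) * (W / (y * y))) * (y * y)) by (field; lra).
    apply Rmult_le_compat_r; [nra | exact B]. }
  replace (2 * (1 - x / y) * (y * y)) with (2 * (y - x) * y) in B' by (field; lra).
  nra.
Qed.

(** * Univalence from a bound on the logarithmic derivative *)

Lemma mean_value_point (g dg : R -> R) :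
  (forall t, 0 <= t <= 1 -> is_derive g t (dg t)) ->
  forall b, 0 <= b <= 1 -> exists c, 0 <= c <= b /\ g b - g 0 = dg c * b.
Proof.
  intros H b Hb.
  destruct (MVT_gen g 0 b dg) as [c [Hc E]].
  - rewrite Rmin_left, Rmax_right by lra. intros; apply H; lra.
  - rewrite Rmin_left, Rmax_right by lra. intros x Hx.
    apply continuity_pt_filterlim.
    apply (ex_derive_continuous (V := R_NormedModule)). exists (dg x). apply H; lra.
  - rewrite Rmin_left, Rmax_right in Hc by lra.
    exists c; split; auto. rewrite E; ring.
Qed.

Lemma Re_Cconj_mult_le (x y : C) : Rabs (Re (Cconj x * y)%C) <= Cmod x * Cmod y.
Proof. rewrite <- (Cmod_conj x), <- Cmod_mult. apply re_le_Cmod. Qed.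

Lemma is_derive_Re_scal (c : C) (g : R -> C) (t : R) (l : C) :
  pderiv g t l -> is_derive (fun s => Re (c * g s)%C) t (Re (c * l)%C).
Proof.
  intros H. rewrite Cmult_comm. apply (pderiv_scal c g t l H).
Qed.

Lemma is_derive_Cmod2 (g : R -> C) (t : R) (l : C) :
  pderiv g t l ->
  is_derive (fun s => Cmod (g s) ^ 2) t (2 * Re (Cconj (g t) * l)%C).
Proof.
  intros [H1 H2].
  assert (E : forall s, Re (g s) * Re (g s) + Im (g s) * Im (g s) = Cmod (g s) ^ 2)
    by (intros s; rewrite Cmod2_alt; ring).
  apply (is_derive_ext _ _ _ _ E).
  replace (2 * Re (Cconj (g t) * l)%C)
    with ((Re l * Re (g t) + Re (g t) * Re l) + (Im l * Im (g t) + Im (g t) * Im l))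
    by (unfold Re, Im; simpl; ring).
  apply (is_derive_plus (V := R_NormedModule));
    apply (is_derive_mult (K := R_AbsRing)); auto; intros; apply Rmult_comm.
Qed.

(** Gronwall: [|y|^2] grows at most by the factor [exp (2 v) <= 3], so
    [|y'| <= sqrt 3 / 2 * |y 0|], which is too slow for [y] to leave the open
    half-plane around [y 0] before time [1]. *)
Lemma slow_path_half_plane (y dy : R -> C) (v : R) :
  0 <= v <= 1 / 2 ->
  (forall t, 0 <= t <= 1 -> pderiv y t (dy t)) ->
  (forall t, 0 <= t <= 1 -> Cmod (dy t) <= v * Cmod (y t)) ->
  y 0 <> 0 -> 0 < Re (Cconj (y 0) * y 1)%C.
Proof.
  intros Hv Hd Hb N.
  assert (P0 : 0 < Cmod (y 0)) by (apply Cmod_gt_0; auto).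
  assert (Growth : forall b, 0 <= b <= 1 -> Cmod (y b) ^ 2 <= 3 * Cmod (y 0) ^ 2).
  { intros b Hb1.
    destruct (mean_value_point
      (fun t => Cmod (y t) ^ 2 * exp (- (2 * v * t)))
      (fun t => (2 * Re (Cconj (y t) * dy t)%C) * exp (- (2 * v * t))
                + Cmod (y t) ^ 2 * (- (2 * v) * exp (- (2 * v * t))))) with (b := b)
      as [c [Hc E]]; auto.
    { intros t Ht.
      apply (is_derive_mult (K := R_AbsRing) (fun t => Cmod (y t) ^ 2)
               (fun t => exp (- (2 * v * t))));
        [apply is_derive_Cmod2, Hd; auto | auto_derive; auto; ring | intros; apply Rmult_comm]. }
    assert (Hneg : (2 * Re (Cconj (y c) * dy c)%C) * exp (- (2 * v * c))
                + Cmod (y c) ^ 2 * (- (2 * v) * exp (- (2 * v * c))) <= 0).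
    { pose proof (exp_pos (- (2 * v * c))) as Pe.
      pose proof (Re_Cconj_mult_le (y c) (dy c)) as B1.
      pose proof (Rle_abs (Re (Cconj (y c) * dy c)%C)).
      pose proof (Hb c ltac:(lra)) as B2. pose proof (Cmod_ge_0 (y c)).
      assert (Cmod (y c) * Cmod (dy c) <= Cmod (y c) * (v * Cmod (y c)))
        by (apply Rmult_le_compat_l; auto).
      assert (Re (Cconj (y c) * dy c)%C <= v * Cmod (y c) ^ 2) by lra.
      nra. }
    rewrite Rmult_0_r, Ropp_0, exp_0, Rmult_1_r in E.
    assert (B : Cmod (y b) ^ 2 * exp (- (2 * v * b)) <= Cmod (y 0) ^ 2) by nra.
    assert (Ee : exp (2 * v * b) <= 3).
    { eapply Rle_trans; [|apply exp_le_3]. apply exp_le. nra. }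
    assert (E1 : exp (- (2 * v * b)) * exp (2 * v * b) = 1)
      by (rewrite <- exp_plus; replace (- (2 * v * b) + 2 * v * b) with 0 by ring; apply exp_0).
    pose proof (exp_pos (2 * v * b)). pose proof (pow2_ge_0 (Cmod (y 0))).
    replace (Cmod (y b) ^ 2)
      with (Cmod (y b) ^ 2 * exp (- (2 * v * b)) * exp (2 * v * b))
      by (rewrite Rmult_assoc, E1; ring).
    apply Rle_trans with (Cmod (y 0) ^ 2 * exp (2 * v * b));
      [apply Rmult_le_compat_r; lra | nra]. }
  destruct (mean_value_point (fun t => Re (Cconj (y 0) * y t)%C)
              (fun t => Re (Cconj (y 0) * dy t)%C)) with (b := 1) as [c [Hc E]]; [|lra|].
  { intros t Ht. apply is_derive_Re_scal, Hd; auto. }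
  assert (E0 : Re (Cconj (y 0) * y 0)%C = Cmod (y 0) ^ 2)
    by (rewrite Cmod2_alt; unfold Re, Im; simpl; ring).
  pose proof (Re_Cconj_mult_le (y 0) (dy c)) as B.
  pose proof (Rle_abs (- Re (Cconj (y 0) * dy c)%C)) as B'. rewrite Rabs_Ropp in B'.
  pose proof (Hb c ltac:(lra)) as Bc. pose proof (Cmod_ge_0 (y c)).
  pose proof (Growth c ltac:(lra)) as Gc.
  (* 7 / 4 exceeds the square root of 3 *)
  assert (Cmod (y c) <= 7 / 4 * Cmod (y 0)) by nra.
  assert (Cmod (dy c) <= 7 / 8 * Cmod (y 0)) by nra.
  cbv beta in E. nra.
Qed.

Lemma ball_segment (a z w : C) (d s : R) :
  Cmod (z - a)%C < d -> Cmod (w - a)%C < d -> 0 <= s <= 1 ->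
  Cmod (z + RtoC s * (w - z) - a)%C < d.
Proof.
  intros Hz Hw Hs.
  replace (z + s * (w - z) - a)%C with (RtoC (1 - s) * (z - a) + RtoC s * (w - a))%C
    by (rewrite RtoC_minus; ring).
  eapply Rle_lt_trans; [apply Cmod_triangle|].
  rewrite !Cmod_mult, !Cmod_R, !Rabs_right by lra.
  destruct (Rle_lt_dec s (1 / 2)); nra.
Qed.

(** The logarithmic derivative of [phi'] is so small that [phi'] stays in the
    open half-plane around [phi' a]. By the Noshiro-Warschawski argument, [phi]
    then strictly advances in the direction [phi' a * u] along any chord of
    direction [u]. *)
Lemma univalent_ball (phi dphi ddphi : C -> C) (a : C) (d kappa : R) :
  0 < d -> 0 <= kappa -> kappa * d <= 1 / 2 ->
  (forall w, Cmod (w - a)%C < d -> cdiff phi w (dphi w)) ->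
  (forall w, Cmod (w - a)%C < d -> cdiff dphi w (ddphi w)) ->
  (forall w, Cmod (w - a)%C < d -> Cmod (ddphi w) <= kappa * Cmod (dphi w)) ->
  dphi a <> 0 ->
  univalent_in phi (fun w => Cmod (w - a)%C < d).
Proof.
  intros Hd Hk Hkd H1 H2 H3 N z w Hz Hw E.
  assert (Haa : Cmod (a - a)%C < d)
    by (replace (a - a)%C with (RtoC 0) by ring; rewrite Cmod_0; auto).
  assert (Half : forall w, Cmod (w - a)%C < d -> 0 < Re (Cconj (dphi a) * dphi w)%C).
  { intros x Hx.
    set (y := fun s => dphi (a + RtoC s * (x - a))%C).
    assert (y0 : y 0 = dphi a) by (unfold y; f_equal; ring).
    assert (y1 : y 1 = dphi x) by (unfold y; f_equal; ring).
    rewrite <- y0, <- y1.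
    apply (slow_path_half_plane y
      (fun s => (x - a) * ddphi (a + RtoC s * (x - a)))%C (kappa * Cmod (x - a)%C)).
    - pose proof (Cmod_ge_0 (x - a)%C). nra.
    - intros s Hs. apply (pderiv_comp dphi (fun s => a + RtoC s * (x - a))%C).
      + apply pderiv_affine.
      + apply H2. apply ball_segment; auto.
    - intros s Hs. unfold y. rewrite Cmod_mult.
      pose proof (H3 _ (ball_segment a a x d s Haa Hx Hs)).
      pose proof (Cmod_ge_0 (x - a)%C). nra.
    - rewrite y0; auto. }
  destruct (Ceq_dec z w) as [|Nzw]; [assumption|exfalso].
  set (u := (w - z)%C).
  assert (Pu : 0 < Cmod u).
  { apply Cmod_gt_0. intro E0. apply Nzw.
    replace w with (w - z + z)%C by ring. fold u. rewrite E0; ring. }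
  set (c := (Cconj (dphi a) * Cconj u)%C).
  destruct (mean_value_point (fun s => Re (c * phi (z + RtoC s * u))%C)
              (fun s => Re (c * (u * dphi (z + RtoC s * u)))%C)) with (b := 1)
    as [s [Hs Es]]; [|lra|].
  { intros s Hs. apply (is_derive_Re_scal c (fun s => phi (z + RtoC s * u)%C)).
    apply (pderiv_comp phi (fun s => z + RtoC s * u)%C); [apply pderiv_affine|].
    apply H1, ball_segment; auto. }
  cbv beta in Es.
  replace (z + RtoC 1 * u)%C with w in Es by (unfold u; ring).
  replace (z + RtoC 0 * u)%C with z in Es by ring.
  rewrite E in Es.
  pose proof (Half _ (ball_segment a z w d s Hz Hw Hs)) as Hh. fold u in Hh.
  replace (c * (u * dphi (z + s * u)))%C
    with (RtoC (Cmod u ^ 2) * (Cconj (dphi a) * dphi (z + s * u)))%C in Es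
    by (rewrite Cmod2_conj; unfold c; ring).
  rewrite re_scal_l in Es.
  assert (0 < Cmod u ^ 2) by (apply pow_lt; auto). nra.
Qed.

(** * Harmonic mappings *)

Lemma unimodular_conj (e : C) : Cmod e = 1 -> (e * Cconj e)%C = 1.
Proof. intros H. rewrite <- Cmod2_conj, H. f_equal; ring. Qed.

(** If [f = h + Cconj g] takes the same value twice, then [h] and [g] have
    increments of the same modulus, so the values of some [h + e * g] agree. *)
Lemma univalent_of_analytic_shears (h g : C -> C) (D : C -> Prop) :
  (forall e, Cmod e = 1 -> univalent_in (fun w => h w + e * g w)%C D) ->
  univalent_in (fun w => h w + Cconj (g w))%C D.
Proof.
  intros H z w Hz Hw E.
  destruct (exists_phase (g z - g w)%C) as [c [Hc1 Hc2]].
  assert (Ec : Cconj (g z - g w)%C = (c * c * (g z - g w))%C).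
  { replace (Cconj (g z - g w))%C with (c * (Cconj c * Cconj (g z - g w)))%C
      by (rewrite Cmult_assoc, (unimodular_conj c Hc1); ring).
    rewrite <- Cmult_conj, Hc2, <- Cmult_assoc, Hc2. f_equal.
    apply C_ext; unfold Re, Im; simpl; ring. }
  apply (H (c * c)%C); auto.
  - rewrite Cmod_mult, Hc1; ring.
  - replace (h z) with (h z + Cconj (g z) - Cconj (g z))%C by ring.
    rewrite E. rewrite Cminus_conj in Ec.
    replace (Cconj (g z)) with (Cconj (g z) - Cconj (g w) + Cconj (g w))%C by ring.
    rewrite Ec. ring.
Qed.

(** For unimodular [e], the pre-Schwarzians of [h + e * g] and of
    [h + Cconj g] differ by a term of modulus [|omega'| / (1 - |omega|^2)],
    where [omega = g' / h'], to which the Schwarz-Pick bound applies. *)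
Lemma analytic_shear_bound (h g : C -> C) (e z : C) (M : R) :
  holo h -> holo g -> sense_preserving h g -> Cmod e = 1 -> Cmod z < 1 ->
  (1 - Cmod z ^ 2) * Cmod (pre_schwarzian h g z) <= M ->
  (1 - Cmod z ^ 2) * Cmod (C_derive (C_derive h) z + e * C_derive (C_derive g) z)%C
  <= (M + 2) * Cmod (C_derive h z + e * C_derive g z)%C.
Proof.
  intros Hh Hg Hsp He Hz HM.
  assert (Hlt : forall w, Cmod w < 1 -> Cmod (C_derive g w) < Cmod (C_derive h w)).
  { intros w Hw. pose proof (Hsp w Hw) as J. unfold jacobian in J.
    apply Rsqr_incrst_0; try apply Cmod_ge_0. rewrite !Rsqr_pow2. lra. }
  pose proof (holo_C_derive h Hh) as Hh'. pose proof (holo_C_derive g Hg) as Hg'.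
  pose proof (weak_schwarz_pick (C_derive g) (C_derive h) z _ _ Hg' Hh' Hlt Hz
                (cdiff_C_derive _ z Hg' Hz) (cdiff_C_derive _ z Hh' Hz)) as SP.
  pose proof (Hsp z Hz) as HJ.
  unfold pre_schwarzian in HM. unfold jacobian in HM, HJ.
  set (h1 := C_derive h z) in *. set (g1 := C_derive g z) in *.
  set (h2 := C_derive (C_derive h) z) in *. set (g2 := C_derive (C_derive g) z) in *.
  set (J := Cmod h1 ^ 2 - Cmod g1 ^ 2) in *.
  assert (NJ : RtoC J <> 0) by (intro E; apply RtoC_inj in E; lra).
  set (P := ((h2 * Cconj h1 - g2 * Cconj g1) / J)%C) in *.
  set (W := (g2 * h1 - g1 * h2)%C) in *.
  assert (EJ : RtoC J = (h1 * Cconj h1 - g1 * Cconj g1)%C)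
    by (unfold J; rewrite RtoC_minus, !Cmod2_conj; reflexivity).
  assert (Conj : Cmod (e * Cconj h1 + Cconj g1)%C = Cmod (h1 + e * g1)%C).
  { rewrite <- Cmod_conj, Cplus_conj, Cmult_conj, !Cconj_conj.
    rewrite <- (Rmult_1_l (Cmod (_ + g1)%C)), <- He, <- Cmod_mult. f_equal.
    replace (e * (Cconj e * h1 + g1))%C with (e * Cconj e * h1 + e * g1)%C by ring.
    rewrite (unimodular_conj e He). ring. }
  assert (Key : (h2 + e * g2)%C
    = (P * (h1 + e * g1) + W * (e * Cconj h1 + Cconj g1) / RtoC J)%C).
  { replace (h2 + e * g2)%C with ((h2 + e * g2) * RtoC J / RtoC J)%C by (field; auto).
    unfold P. field_simplify_eq; [|exact NJ]. rewrite EJ. unfold W. ring. }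
  assert (Pz : 0 < 1 - Cmod z ^ 2) by (pose proof (Cmod_ge_0 z); nra).
  rewrite Key.
  eapply Rle_trans; [apply Rmult_le_compat_l; [lra | apply Cmod_triangle]|].
  rewrite Cmod_div by auto. rewrite !Cmod_mult, Conj, Cmod_R, (Rabs_right J) by lra.
  set (x := Cmod (h1 + e * g1)%C). assert (Px : 0 <= x) by apply Cmod_ge_0.
  assert (A1 : (1 - Cmod z ^ 2) * (Cmod P * x) <= M * x).
  { rewrite <- Rmult_assoc. apply Rmult_le_compat_r; auto. }
  assert (A2 : (1 - Cmod z ^ 2) * (Cmod W * x / J) <= 2 * x).
  { replace ((1 - Cmod z ^ 2) * (Cmod W * x / J))
      with ((1 - Cmod z ^ 2) * Cmod W * / J * x) by (field; lra).
    apply Rmult_le_compat_r; auto. apply Rle_div_l; lra. }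
  lra.
Qed.

(** On the ball, [1 - |w|^2] exceeds [4 / 7 * (1 - |a|^2)], so the bound
    [(M + 2) / (1 - |w|^2)] on the logarithmic derivative, times the radius, is
    at most [(M + 2) / (4 * (M + 1)) <= 1 / 2]. *)
Lemma euclidean_ball_univalent (f h g : C -> C) (M : R) (a : C) :
  harmonic_mapping f h g -> sense_preserving h g -> 0 <= M ->
  (forall z, Cmod z < 1 -> (1 - Cmod z ^ 2) * Cmod (pre_schwarzian h g z) <= M) ->
  Cmod a < 1 ->
  univalent_in f (fun w => Cmod (w - a)%C < (1 - Cmod a ^ 2) / (7 * (M + 1))).
Proof.
  intros [Hh [Hg [_ Hf]]] Hsp HM0 HM Ha.
  assert (holoh : holo h).
  { intros w Hw. destruct (Hh w Hw) as [l Hl]. exists l. apply cdiff_of_is_derive; auto. }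
  assert (holog : holo g).
  { intros w Hw. destruct (Hg w Hw) as [l Hl]. exists l. apply cdiff_of_is_derive; auto. }
  pose proof (Cmod_ge_0 a) as Pa.
  set (U := 1 - Cmod a ^ 2). assert (HU : 0 < U) by (unfold U; nra).
  set (d := U / (7 * (M + 1))).
  assert (Hd : 0 < d) by (apply Rdiv_lt_0_compat; lra).
  assert (Hd7 : d <= U / 7).
  { apply Rmult_le_compat_l; [lra|]. apply Rinv_le_contravar; lra. }
  (* From |w| < |a| + U / 7, 1 - |w|^2 >= (1 - 2 / 7 - 1 / 49) * U. *)
  assert (Hball : forall w, Cmod (w - a)%C < d -> 4 / 7 * U <= 1 - Cmod w ^ 2).
  { intros w Hw. pose proof (Cmod_ge_sub w a). pose proof (Cmod_ge_0 w).
    assert (Cmod w ^ 2 <= (Cmod a + U / 7) ^ 2).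
    { apply pow_incr; lra. }
    unfold U in *. nra. }
  assert (Hdisk : forall w, Cmod (w - a)%C < d -> Cmod w < 1).
  { intros w Hw. pose proof (Hball w Hw). pose proof (Cmod_ge_0 w). nra. }
  intros z w Hz Hw E.
  rewrite (Hf z), (Hf w) in E by (apply Hdisk; auto).
  revert z w Hz Hw E.
  apply (univalent_of_analytic_shears h g (fun w => Cmod (w - a)%C < d)).
  intros e He.
  apply (univalent_ball _ (fun w => C_derive h w + e * C_derive g w)%C
           (fun w => C_derive (C_derive h) w + e * C_derive (C_derive g) w)%C
           a d ((M + 2) / (4 / 7 * U))); auto.
  - apply Rlt_le, Rdiv_lt_0_compat; lra.
  - unfold d.
    replace ((M + 2) / (4 / 7 * U) * (U / (7 * (M + 1)))) with ((M + 2) / (4 * (M + 1)))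
      by (field; lra).
    apply Rle_div_l; lra.
  - intros w Hw. apply cdiff_plus; [|apply cdiff_scal]; apply cdiff_C_derive; auto.
  - intros w Hw. apply cdiff_plus; [|apply cdiff_scal]; apply cdiff_C_derive; auto;
      apply holo_C_derive; auto.
  - intros w Hw.
    pose proof (analytic_shear_bound h g e w M holoh holog Hsp He (Hdisk w Hw)
                  (HM w (Hdisk w Hw))) as B.
    pose proof (Hball w Hw) as B2.
    set (x := Cmod (C_derive (C_derive h) w + e * C_derive (C_derive g) w)%C) in *.
    set (y := Cmod (C_derive h w + e * C_derive g w)%C) in *.
    assert (0 <= x) by apply Cmod_ge_0.
    replace ((M + 2) / (4 / 7 * U) * y) with ((M + 2) * y / (4 / 7 * U)) by (field; lra).
    apply Rle_div_r; [lra|]. nra.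
  - apply Cmod_gt_0. pose proof (Hsp a Ha) as J. unfold jacobian in J.
    pose proof (Cmod_ge_sub (C_derive h a) (- (e * C_derive g a))%C) as B.
    rewrite Cmod_opp, Cmod_mult, He in B.
    replace (C_derive h a - - (e * C_derive g a))%C
      with (C_derive h a + e * C_derive g a)%C in B by ring.
    pose proof (Cmod_ge_0 (C_derive h a)). pose proof (Cmod_ge_0 (C_derive g a)). nra.
Qed.

(** * Hyperbolic disks *)

Lemma artanh_le (x y : R) : 0 <= x <= y -> y < 1 -> artanh x <= artanh y.
Proof.
  intros H Hy. unfold artanh. apply Rmult_le_compat_r; [lra|].
  apply ln_le; [apply Rdiv_lt_0_compat; lra|].
  apply Rle_div_l; [lra|].
  replace ((1 + y) / (1 - y) * (1 - x)) with ((1 + y) * (1 - x) / (1 - y)) by (field; lra).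
  apply Rle_div_r; [lra|]. nra.
Qed.

Lemma artanh_pos (x : R) : 0 < x < 1 -> 0 < artanh x.
Proof.
  intros H. unfold artanh. apply Rdiv_lt_0_compat; [|lra].
  rewrite <- ln_1. apply ln_increasing; [lra|].
  apply Rlt_div_r; lra.
Qed.

(** The hyperbolic disk is [|z - a| < r * |1 - Cconj a * z|], and
    [|1 - Cconj a * z| <= 1 - |a|^2 + |z - a|]; the factor [8 / 7] bounds
    [1 / (1 - r)]. *)
Lemma hyp_disk_in_ball (a z : C) (r : R) :
  0 < r <= 1 / 8 -> Cmod a < 1 -> hyp_disk a (2 * artanh r) z ->
  Cmod (z - a)%C < 8 / 7 * r * (1 - Cmod a ^ 2).
Proof.
  intros Hr Ha [Hz Hdist]. unfold unit_disk in Hz. unfold hyp_dist in Hdist.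
  pose proof (Cmod_ge_0 a) as Pa. pose proof (Cmod_ge_0 (z - a)%C) as Pza.
  assert (Eq : ((z - a) / (1 - Cconj a * z))%C = disk_automorphism (- a) z).
  { unfold disk_automorphism. rewrite Copp_conj. f_equal; ring. }
  rewrite Eq in Hdist.
  assert (Q1 : Cmod (disk_automorphism (- a) z) < 1)
    by (apply disk_automorphism_in_disk; [rewrite Cmod_opp|]; auto).
  assert (Q : Cmod (disk_automorphism (- a) z) < r).
  { apply Rnot_le_lt; intro N.
    pose proof (artanh_le r _ ltac:(split; [lra | exact N]) Q1). lra. }
  assert (ND : (1 + Cconj (- a) * z)%C <> 0)
    by (apply disk_automorphism_denominator; [rewrite Cmod_opp|]; auto).
  unfold disk_automorphism in Q. rewrite Cmod_div in Q by auto.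
  apply Rlt_div_l in Q; [|apply Cmod_gt_0; auto].
  replace (z + - a)%C with (z - a)%C in Q by ring.
  assert (B : Cmod (1 + Cconj (- a) * z)%C <= (1 - Cmod a ^ 2) + Cmod a * Cmod (z - a)%C).
  { replace (1 + Cconj (- a) * z)%C
      with (RtoC (1 - Cmod a ^ 2) - Cconj a * (z - a))%C
      by (rewrite RtoC_minus, Cmod2_conj, Copp_conj; ring).
    eapply Rle_trans; [apply Cmod_sub_triangle|].
    rewrite Cmod_mult, Cmod_conj, Cmod_R, Rabs_right by nra. lra. }
  set (x := Cmod (z - a)%C) in *. set (U := 1 - Cmod a ^ 2) in *.
  assert (x < r * (U + x)).
  { eapply Rlt_le_trans; [exact Q|]. apply Rmult_le_compat_l; [lra|]. nra. }
  assert (r * x <= 1 / 8 * x) by (apply Rmult_le_compat_r; lra).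
  lra.
Qed.

Theorem theorem3p3 (f h g : C -> C) (M : R)
  (hf : harmonic_mapping f h g)
  (hsp : sense_preserving h g)
  (hM : Rbar_le (pre_schwarzian_norm h g) (Finite M)) :
  let t := 2 * artanh (1 / (8 * (M + 1))) in
  (forall z : C, unit_disk z -> univalent_in f (hyp_disk z t)) /\
  uniformly_locally_univalent f /\
  Rbar_le (Finite t) (hyp_radius f).
Proof.
  intros t.
  assert (HM : forall z, Cmod z < 1 ->
    (1 - Cmod z ^ 2) * Cmod (pre_schwarzian h g z) <= M).
  { intros z Hz.
    destruct (Lub_Rbar_correct (fun x : R => exists z : C,
      unit_disk z /\ x = (1 - Cmod z ^ 2) * Cmod (pre_schwarzian h g z))) as [Hub _].
    apply (Rbar_le_trans (Finite _) (pre_schwarzian_norm h g) (Finite M)); [|exact hM].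
    apply Hub. exists z; split; auto. }
  assert (HM0 : 0 <= M).
  { eapply Rle_trans; [|apply (HM 0); rewrite Cmod_0; lra].
    rewrite Cmod_0. pose proof (Cmod_ge_0 (pre_schwarzian h g 0)). nra. }
  set (r := 1 / (8 * (M + 1))) in *.
  assert (Hr : 0 < r <= 1 / 8).
  { split; [apply Rdiv_lt_0_compat; lra|].
    apply Rmult_le_compat_l; [lra|]. apply Rinv_le_contravar; lra. }
  assert (Ht : 0 < t) by (unfold t; pose proof (artanh_pos r); lra).
  assert (Uni : forall z, unit_disk z -> univalent_in f (hyp_disk z t)).
  { intros a Ha z w Hz Hw E.
    assert (Ed : 8 / 7 * r * (1 - Cmod a ^ 2) = (1 - Cmod a ^ 2) / (7 * (M + 1)))
      by (unfold r; field; lra).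
    apply (euclidean_ball_univalent f h g M a hf hsp HM0 HM Ha); auto;
      rewrite <- Ed; apply hyp_disk_in_ball; auto. }
  assert (Rad : Rbar_le (Finite t) (hyp_radius f)).
  { unfold hyp_radius, Rbar_glb.
    match goal with |- context [Rbar_ex_glb ?E] => destruct (Rbar_ex_glb E) as [l Hl] end.
    apply (proj2 Hl).
    intros x [z [Hz ->]].
    apply (proj1 (Lub_Rbar_correct (fun r : R => 0 < r /\ univalent_in f (hyp_disk z r)))).
    split; auto. }
  split; [exact Uni | split; [|exact Rad]].
  apply (Rbar_lt_le_trans _ (Finite t)); [exact Ht | exact Rad].
Qed.
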